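(* Suppose that $N\ge 1$ and suppose that $(\gamma_{0,N}^{(k)})_{k\in\mathbb{N}}\in\mathcal{H}^1$ is a sequence such that for all $k\in\mathbb{N}$ one has $(\gamma_{0,N}^{(k)})^\wedge(n_1,\dots,n_k;n_1',\dots,n_k')=0$ if some $|n_j|>N$ or if some $|n_j'|>N$. Then there exists a constant $C_1>0$ such that for all $k\in\mathbb{N}$ and for all $j\in\{1,\dots,k\}$, $$\|S^{(k,1)}B_{j,k+1}\,\mathcal{U}^{(k+1)}(t)\gamma_{0,N}^{(k+1)}\|_{L^2([0,2\pi]\times\Lambda^k\times\Lambda^k)}\le C_1\,\ln N\,\|S^{(k+1,1)}\gamma_{0,N}^{(k+1)}\|_{L^2(\Lambda^{k+1}\times\Lambda^{k+1})}.$$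
   Context: $\Lambda=\mathbb{T}^3=(\mathbb{R}/2\pi\mathbb{Z})^3$; $\vec{x}_k=(x_1,\dots,x_k)$, $\vec{x}_k'=(x_1',\dots,x_k')$ with $x_j,x_j'\in\Lambda$. All $k$-particle density matrices $\gamma_0^{(k)}:\Lambda^k\times\Lambda^k\to\mathbb{C}$ satisfy $\gamma_0^{(k)}(\vec{x}_k;\vec{x}_k')=\overline{\gamma_0^{(k)}(\vec{x}_k';\vec{x}_k)}$ and $\gamma_0^{(k)}(x_{\sigma(1)},\dots,x_{\sigma(k)};x'_{\sigma(1)},\dots,x'_{\sigma(k)})=\gamma_0^{(k)}(\vec{x}_k;\vec{x}_k')$ for all $\sigma\in S_k$. Fourier transform: $(\gamma_0^{(k)})^{\wedge}(\vec{n}_k;\vec{n}_k')=\int_{\Lambda^k\times\Lambda^k}\gamma_0^{(k)}(\vec{x}_k;\vec{x}_k')e^{-i\sum_{j=1}^k\langle x_j,n_j\rangle+i\sum_{j=1}^k\langle x_j',n_j'\rangle}\,d\vec{x}_k\,d\vec{x}_k'$, with $\vec{n}_k=(n_1,\dots,n_k)$, $\vec{n}_k'=(n_1',\dots,n_k')\in(\mathbb{Z}^3)^k$. $S^{(k,1)}=\prod_{j=1}^k(1-\Delta_{x_j})^{1/2}(1-\Delta_{x_j'})^{1/2}$. A sequence $(\gamma_0^{(k)})_k$ of $k$-particle density matrices belongs to $\mathcal{H}^1$ if $\|S^{(k,1)}\gamma_0^{(k)}\|_{L^2(\Lambda^k\times\Lambda^k)}<\infty$ for all $k$. Free evolution (identifying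 operators with their kernels): $\mathcal{U}^{(k)}(t)\gamma_0^{(k)}=e^{it\sum_{j=1}^k\Delta_{x_j}}\gamma_0^{(k)}e^{-it\sum_{j=1}^k\Delta_{x_j'}}$, i.e. multiplication of $(\gamma_0^{(k)})^\wedge(\vec{n}_k;\vec{n}_k')$ by $e^{-it(|\vec{n}_k|^2-|\vec{n}_k'|^2)}$. Collision operator: for $1\le j\le k$, $B_{j,k+1}=B^+_{j,k+1}-B^-_{j,k+1}$, where $$B^{+}_{j,k+1}(\gamma_0^{(k+1)})(\vec{x}_k;\vec{x}_k')=\int_\Lambda \delta(x_j-x_{k+1})\,\gamma_0^{(k+1)}(\vec{x}_k,x_{k+1};\vec{x}_k',x_{k+1})\,dx_{k+1},$$ $$B^{-}_{j,k+1}(\gamma_0^{(k+1)})(\vec{x}_k;\vec{x}_k')=\int_\Lambda \delta(x_j'-x_{k+1})\,\gamma_0^{(k+1)}(\vec{x}_k,x_{k+1};\vec{x}_k',x_{k+1})\,dx_{k+1},$$ with $\delta$ the Dirac delta function.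
   Formalization: The claim is false at N=1 (ln 1=0 while the left side can be nonzero), so N≥1 is replaced by N≥N0 for an arbitrary fixed N0>1, with C_1 depending only on N0 (N0=2 covers all integers N≥2). *)

(* Defs.v *)
From HB Require Import structures.
From mathcomp Require Import all_boot all_order all_algebra all_fingroup.
From mathcomp Require Import all_classical all_reals all_analysis.
From mathcomp Require Import complex.

Set Implicit Arguments.
Unset Strict Implicit.
Unset Printing Implicit Defensive.

Import Order.TTheory GRing.Theory Num.Theory.
Import numFieldNormedType.Exports.

Local Open Scope classical_set_scope.
Local Open Scope ring_scope.

(** * Products of finite measures *)

Section mprod.
Context (d1 d2 : measure_display) (T1 : measurableType d1)
  (T2 : measurableType d2) (R : realType).
Variables (mu : {finite_measure set T1 -> \bar R})
  (nu : {finite_measure set T2 -> \bar R}).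

Definition mprod : set (T1 * T2) -> \bar R := (mu \x nu)%E.

HB.instance Definition _ := Measure.copy mprod (mu \x nu)%E.

Let mprod_fin : fin_num_fun mprod.
Proof.
move=> A mA; rewrite ge0_fin_numE ?measure_ge0//.
apply: (@le_lt_trans _ _ (mprod (setT `*` setT))).
  by apply: le_measure; rewrite ?inE// setXTT.
rewrite /mprod product_measure1E//.
rewrite lte_mul_pinfty ?measure_ge0 ?fin_num_measure//.
by rewrite ltey_eq fin_num_measure.
Qed.

HB.instance Definition _ := Measure_isFinite.Build _ _ _ mprod mprod_fin.

End mprod.

Section mcons.
Context (d : measure_display) (T : measurableType d) (R : realType) (n : nat).
Variables (mu : {finite_measure set T -> \bar R})
  (nu : {finite_measure set (n.-tuple T) -> \bar R}).

Definition cons_tuple_pair (z : T * n.-tuple T) : n.+1.-tuple T :=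
  [the n.+1.-tuple T of z.1 :: z.2].

Lemma measurable_cons_tuple_pair : measurable_fun setT cons_tuple_pair.
Proof. exact: measurable_cons. Qed.

Definition mcons : set (n.+1.-tuple T) -> \bar R :=
  pushforward (mprod mu nu) cons_tuple_pair.

HB.instance Definition _ := Measure.copy mcons
  (measure_function_pushforward__canonical__measure_function_Measure
    (mprod mu nu) measurable_cons_tuple_pair).

Let mcons_fin : fin_num_fun mcons.
Proof.
move=> A mA; rewrite /mcons /pushforward fin_num_measure//.
by rewrite -[X in measurable X]setTI; exact: measurable_cons_tuple_pair.
Qed.

HB.instance Definition _ := Measure_isFinite.Build _ _ _ mcons mcons_fin.

End mcons.

(** The [n]-fold product [mu \x ... \x mu] on the product sigma-algebra of
    [n.-tuple T]. *)
Fixpoint mpow (d : measure_display) (T : measurableType d) (R : realType)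
    (mu : {finite_measure set T -> \bar R}) (n : nat) :
    {finite_measure set (n.-tuple T) -> \bar R} :=
  match n with
  | 0 => [the {finite_measure set (0.-tuple T) -> \bar R} of dirac [tuple]]
  | m.+1 => [the {finite_measure set (m.+1.-tuple T) -> \bar R}
              of mcons mu (mpow mu m)]
  end.

(** * The torus

    A function on the torus is a 2 pi-periodic function on the whole space,
    and it is integrated over the fundamental domain [0, 2 pi]. *)

Lemma lebesgue_period_lty (R : realType) :
  ((@lebesgue_measure R) `[0%R, (2 * pi)%R]%classic < +oo)%E.
Proof. by rewrite lebesgue_measure_itv/=; case: ifP => _; rewrite ltry. Qed.

Definition period_measure (R : realType) :
    {finite_measure set (measurableTypeR R) -> \bar R} :=
  @mfrestr _ (measurableTypeR R) R _ (@lebesgue_measure R)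
    (measurable_itv `[0%R, 2 * pi]) (lebesgue_period_lty R).

Definition space (R : realType) := 3.-tuple (measurableTypeR R).

Definition config (R : realType) (k : nat) := k.-tuple (space R).

Definition config_measure (R : realType) (k : nat) :
    {finite_measure set (config R k) -> \bar R} :=
  mpow (mpow (period_measure R) 3) k.

Definition pcoord (R : realType) (k : nat) (x : config R k) (j : 'I_k)
    (i : 'I_3) : R := tnth (tnth x j) i.

Definition freq (k : nat) := k.-tuple (3.-tuple int).

Definition fcoord (k : nat) (n : freq k) (j : 'I_k) (i : 'I_3) : int :=
  tnth (tnth n j) i.

(** * Complex-valued functions *)

Definition cabs (R : realType) (z : R[i]) : R := complex.Re `|z|.

Definition cexpi (R : realType) (theta : R) : R[i] :=
  (cos theta +i* sin theta)%C.

Definition clim (R : realType) (u : nat -> R[i]) : R[i] :=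
  (lim (complex.Re (u M) @[M --> \oo]) +i*
   lim (complex.Im (u M) @[M --> \oo]))%C.

Definition cint (d : measure_display) (T : measurableType d) (R : realType)
    (mu : {measure set T -> \bar R}) (f : T -> R[i]) : R[i] :=
  (Rintegral mu setT (fun z => complex.Re (f z)) +i*
   Rintegral mu setT (fun z => complex.Im (f z)))%C.

Definition cmeasurable (d : measure_display) (T : measurableType d)
    (R : realType) (f : T -> R[i]) : Prop :=
  measurable_fun setT (fun z => complex.Re (f z) : measurableTypeR R) /\
  measurable_fun setT (fun z => complex.Im (f z) : measurableTypeR R).

Definition L2norm (d : measure_display) (T : measurableType d) (R : realType)
    (mu : {measure set T -> \bar R}) (f : T -> R[i]) : \bar R :=
  Lnorm mu 2%:E (fun z => (cabs (f z))%:E).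

(** * Density matrices *)

Definition integral_kernel (R : realType) (k : nat) :=
  config R k -> config R k -> R[i].

Definition uncurry_kernel (R : realType) (k : nat) (g : integral_kernel R k)
    (z : config R k * config R k) : R[i] := g z.1 z.2.

Definition kernel_measure (R : realType) (k : nat) :
    {finite_measure set (config R k * config R k)%type -> \bar R} :=
  mprod (config_measure R k) (config_measure R k).

Definition kernel_L2norm (R : realType) (k : nat)
    (g : integral_kernel R k) : \bar R :=
  L2norm (kernel_measure R k) (uncurry_kernel g).

Definition in_L2 (R : realType) (k : nat) (g : integral_kernel R k) : Prop :=
  cmeasurable (uncurry_kernel g) /\ (kernel_L2norm g < +oo)%E.

(** Norm of L^2([0, 2 pi] x Lambda^k x Lambda^k). *)
Definition spacetime_L2norm (R : realType) (k : nat)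
    (G : R -> integral_kernel R k) : \bar R :=
  L2norm (mprod (period_measure R) (kernel_measure R k))
    (fun z => G z.1 z.2.1 z.2.2).

Definition translate (R : realType) (k : nat) (a : freq k) (x : config R k) :
    config R k :=
  [tuple [tuple pcoord x j i + 2 * pi * (fcoord a j i)%:~R | i < 3] | j < k].

Definition permute (R : realType) (k : nat) (s : {perm 'I_k})
    (x : config R k) : config R k := [tuple tnth x (s j) | j < k].

Definition density_matrix (R : realType) (k : nat)
    (g : integral_kernel R k) : Prop :=
  [/\ forall (a a' : freq k) (x x' : config R k),
        g (translate a x) (translate a' x') = g x x',
      forall x x' : config R k, g x x' = ((g x' x)^*)%C
    & forall (s : {perm 'I_k}) (x x' : config R k),
        g (permute s x) (permute s x') = g x x'].

(** * Fourier analysis *)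

Definition pairing (R : realType) (k : nat) (x : config R k) (n : freq k) : R :=
  \sum_(j < k) \sum_(i < 3) pcoord x j i * (fcoord n j i)%:~R.

Definition fourier (R : realType) (k : nat)
    (g : integral_kernel R k) (n n' : freq k) : R[i] :=
  cint (kernel_measure R k)
    (fun z => g z.1 z.2 * cexpi (- pairing z.1 n + pairing z.2 n')).

(** Frequencies all of whose coordinates lie in [-M, M], the index [a] standing
    for the frequency [a - M]. *)
Definition box_freq (k M : nat) (a : k.-tuple (3.-tuple 'I_(M.*2.+1))) :
    freq k :=
  [tuple [tuple (tnth (tnth a j) i : nat)%:Z - M%:Z | i < 3] | j < k].

Definition partial_fourier_series (R : realType) (k : nat)
    (c : freq k -> freq k -> R[i]) (M : nat) : integral_kernel R k :=
  fun x x' => ((((2 * pi) ^+ (6 * k))^-1 : R)%:C)%C *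
    \sum_(a : k.-tuple (3.-tuple 'I_(M.*2.+1)))
    \sum_(a' : k.-tuple (3.-tuple 'I_(M.*2.+1)))
      c (box_freq a) (box_freq a') *
      cexpi (pairing x (box_freq a) - pairing x' (box_freq a')).

(** The function whose Fourier transform is [m] times that of [g], namely the
    pointwise sum of its Fourier series over growing cubes. The partial sums
    are eventually constant when [fourier g] has finite support; where they
    diverge, the value is meaningless. *)
Definition multiplier (R : realType) (k : nat) (m : freq k -> freq k -> R[i])
    (g : integral_kernel R k) : integral_kernel R k :=
  fun x x' => clim (fun M => partial_fourier_series
    (fun n n' => m n n' * fourier g n n') M x x').

Definition sqnorm1 (R : realType) (k : nat) (n : freq k) (j : 'I_k) : R :=
  \sum_(i < 3) ((fcoord n j i)%:~R) ^+ 2.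

Definition norm1 (R : realType) (k : nat) (n : freq k) (j : 'I_k) : R :=
  Num.sqrt (sqnorm1 R n j).

Definition sqnorm (R : realType) (k : nat) (n : freq k) : R :=
  \sum_(j < k) sqnorm1 R n j.

(** Symbol of prod_j (1 - Laplacian_{x_j})^(1/2) (1 - Laplacian_{x_j'})^(1/2). *)
Definition S_symbol (R : realType) (k : nat) (n n' : freq k) : R[i] :=
  ((\prod_(j < k) (Num.sqrt (1 + sqnorm1 R n j) *
                   Num.sqrt (1 + sqnorm1 R n' j)))%:C)%C.

Definition S_op (R : realType) (k : nat)
    (g : integral_kernel R k) : integral_kernel R k :=
  multiplier (@S_symbol R k) g.

Definition U_symbol (R : realType) (k : nat) (t : R) (n n' : freq k) : R[i] :=
  cexpi (- (t * (sqnorm R n - sqnorm R n'))).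

Definition U_op (R : realType) (k : nat) (t : R) (g : integral_kernel R k) :
    integral_kernel R k :=
  multiplier (@U_symbol R k t) g.

(** Some [h] in L^2 has the Fourier coefficients of [S_op (gamma k)]; finiteness
    of [kernel_L2norm (S_op (gamma k))] would not be the right condition, since
    the series defining [S_op] may diverge. *)
Definition in_H1 (R : realType)
    (gamma : forall k, integral_kernel R k) : Prop :=
  forall k, (0 < k)%N ->
    in_L2 (gamma k) /\
    exists2 h : integral_kernel R k, in_L2 h &
      forall n n' : freq k,
        fourier h n n' = S_symbol R n n' * fourier (gamma k) n n'.

(** * The collision operator *)

Definition extend (R : realType) (k : nat) (x : config R k) (y : space R) :
    config R k.+1 := [tuple of rcons x y].

(** [delta (x_j - y) dy] is the Dirac measure at [x_j]; the integrand being
    periodic in [y], any representative [x_j] of the point of the torus will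
    do. *)
Definition Bplus (R : realType) (k : nat) (j : 'I_k)
    (g : integral_kernel R k.+1) : integral_kernel R k :=
  fun x x' => cint (@dirac _ _ (tnth x j) R)
    (fun y => g (extend x y) (extend x' y)).

Definition Bminus (R : realType) (k : nat) (j : 'I_k)
    (g : integral_kernel R k.+1) : integral_kernel R k :=
  fun x x' => cint (@dirac _ _ (tnth x' j) R)
    (fun y => g (extend x y) (extend x' y)).

Definition B_op (R : realType) (k : nat) (j : 'I_k)
    (g : integral_kernel R k.+1) : integral_kernel R k :=
  fun x x' => Bplus j g x x' - Bminus j g x x'.

(** The Fourier transform of [g] is supported in
    |n_1|, ..., |n_k|, |n_1'|, ..., |n_k'| <= N. *)
Definition band_limited (R : realType) (k : nat) (N : R)
    (g : integral_kernel R k) : Prop :=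
  forall n n' : freq k,
    (exists j : 'I_k, N < norm1 R n j \/ N < norm1 R n' j) ->
    fourier g n n' = 0.

(* Main.v *)
Require Import Defs.
From mathcomp Require Import all_boot all_order all_algebra.
From mathcomp Require Import all_classical all_reals all_analysis.
From mathcomp Require Import complex measurable_realfun.
From mathcomp Require Import zify ring lra.
Import Order.TTheory GRing.Theory Num.Theory.
Import numFieldNormedType.Exports.
Set Implicit Arguments.
Unset Strict Implicit.
Unset Printing Implicit Defensive.
Local Open Scope ring_scope.

(** All functions involved are trigonometric polynomials, so by Parseval on
    [0, 2 pi] x Lambda^k x Lambda^k and a Schur test the estimate reduces to
      sum <nu>^2 / (<n1>^2 <n2>^2 <n3>^2) <= C (1 + log N)^2
    over the n1, n2, n3 in Z^3 with |n_i| <= N, n1 + n2 - n3 = nu and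
    |n1|^2 + |n2|^2 - |n3|^2 = tau, uniformly in nu and tau; the constraint says
    that (n1 - nu) . (n2 - nu) is constant.  If n1 = nu or n2 = nu the sum is one
    of <n>^-4.  Otherwise <nu>^2 <= 3 (<n1>^2 + <n2>^2 + <n3>^2) leaves sums of
    <x>^-2 <y>^-2 over two of the n_i, and it is enough to bound the number of
    pairs with |x| <= A and |y| <= B by C A^2 B^2, for then each of the log^2 N
    pairs of dyadic scales contributes O(1).  For fixed y the points x lie on a
    plane with normal p affine in y, which has O(A^2 / |p'| + A) lattice points
    of size A, where p = gcd(p) p'; and 1 / |p'| sums to O(B^2) over p in a cube
    of side B.  This is enough if at most O(A B^2) normals p occur, which is
    clear for B <= A.  For the pair (n2, n3) with A <= B one uses instead the
    normals p = n2 - n3: those whose plane meets the cube of side A lie in a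
    thin spherical shell, which has O(A B^2) lattice points. *)

(** * Sums over sets of lattice points *)

Section SumLe.
Variable R : archiRealFieldType.

(* P need be neither finite nor decidable: the sum of w over P is bounded
   through its finite partial sums. *)
Definition sum_le (T : eqType) (P : T -> Prop) (w : T -> R) (K : R) : Prop :=
  forall s : seq T, uniq s -> {in s, forall x, P x} -> \sum_(x <- s) w x <= K.

Lemma ler_sum_in (T : eqType) (s : seq T) (w w' : T -> R) :
  {in s, forall x, w x <= w' x} -> \sum_(x <- s) w x <= \sum_(x <- s) w' x.
Proof. by move=> H; rewrite [leLHS]big_seq [leRHS]big_seq ler_sum. Qed.

Lemma sum_le_mono (T : eqType) (P P' : T -> Prop) (w w' : T -> R) K K' :
  (forall x, P x -> P' x) -> (forall x, P x -> w x <= w' x) -> K' <= K ->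
  sum_le P' w' K' -> sum_le P w K.
Proof.
move=> PP' ww' KK' H s us sP; apply: le_trans KK'.
apply: le_trans (H s us _); last by move=> x /sP /PP'.
by apply: ler_sum_in => x /sP /ww'.
Qed.

(** The finite list is regrouped by its values under [f]. Only the fibres that it meets occur, so
    neither [P] nor [Q] has to be decidable. *)
Lemma sum_le_fiber (T U : eqType) (f : T -> U) (Q : U -> Prop) (P : T -> Prop)
    (w' : U -> R) (w : T -> R) K :
  (forall x, P x -> Q (f x)) ->
  (forall y, Q y -> sum_le (fun x => P x /\ f x = y) w (w' y)) ->
  sum_le Q w' K -> sum_le P w K.
Proof.
move=> PQ fib H s us sP.
have -> : \sum_(x <- s) w x =
    \sum_(y <- undup (map f s)) \sum_(x <- s | f x == y) w x.
  rewrite (exchange_big_dep predT)//= big_seq [RHS]big_seq.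
  apply: eq_bigr => x xs.
  rewrite -big_filter (@eq_filter _ _ (pred1 (f x))) => [|y]; last exact: eq_sym.
  have yU : f x \in undup (map f s) by rewrite mem_undup map_f.
  by rewrite (filter_pred1_uniq (undup_uniq _) yU) big_seq1.
have /(H _ (undup_uniq _)) : {in undup (map f s), forall y, Q y}.
  by move=> y; rewrite mem_undup => /mapP[x /sP/PQ Qx ->].
apply: le_trans.
apply: ler_sum_in => y.
rewrite mem_undup => /mapP[x xs yE]; rewrite -big_filter; apply: fib.
- by rewrite yE; apply/PQ/sP.
- exact: filter_uniq.
- by move=> z; rewrite mem_filter => /andP[/eqP <- /sP].
Qed.

Lemma sum_le_inj (T U : eqType) (f : T -> U) (Q : U -> Prop) (P : T -> Prop)
    (w' : U -> R) (w : T -> R) K :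
  (forall x, P x -> Q (f x)) ->
  (forall x, P x -> w x <= w' (f x)) ->
  (forall x y, P x -> P y -> f x = f y -> x = y) ->
  sum_le Q w' K -> sum_le P w K.
Proof.
move=> PQ ww' fI H s us sP.
apply: le_trans (H (map f s) _ _).
- by rewrite big_map; apply: ler_sum_in => x /sP; exact: ww'.
- by rewrite map_inj_in_uniq// => x y /sP Px /sP; apply: fI.
- by move=> y /mapP[x /sP/PQ ? ->].
Qed.

Lemma sum_le_split (T : eqType) (b : pred T) (P : T -> Prop) (w : T -> R) K1 K2 :
  sum_le (fun x => P x /\ b x) w K1 -> sum_le (fun x => P x /\ ~~ b x) w K2 ->
  sum_le P w (K1 + K2).
Proof.
move=> H1 H2 s us sP; rewrite (bigID b)/= lerD// -big_filter.
- apply: H1; rewrite ?filter_uniq// => x.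
  by rewrite mem_filter => /andP[? /sP].
- apply: H2; rewrite ?filter_uniq// => x.
  by rewrite mem_filter => /andP[? /sP].
Qed.

Lemma sum_leD (T : eqType) (P : T -> Prop) (w1 w2 : T -> R) K1 K2 :
  sum_le P w1 K1 -> sum_le P w2 K2 -> sum_le P (fun x => w1 x + w2 x) (K1 + K2).
Proof. by move=> H1 H2 s us sP; rewrite big_split lerD ?H1 ?H2. Qed.

Lemma sum_leZ (T : eqType) (P : T -> Prop) (w : T -> R) c K :
  0 <= c -> sum_le P w K -> sum_le P (fun x => c * w x) (c * K).
Proof. by move=> c0 H s us sP; rewrite -mulr_sumr ler_wpM2l ?H. Qed.

Lemma sum_le_cst (T : eqType) (P : T -> Prop) (w : T -> R) c K :
  0 <= c -> (forall x, P x -> w x <= c) -> sum_le P (fun=> 1) K ->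
  sum_le P w (c * K).
Proof.
move=> c0 wc /(sum_leZ c0); apply: sum_le_mono => // x Px.
by rewrite mulr1 wc.
Qed.

(** The empty list sums to 0, so a bound may be proved with a base point of [P] at hand. *)
Lemma sum_le_nonempty (T : eqType) (P : T -> Prop) (w : T -> R) K :
  0 <= K -> (forall x0, P x0 -> sum_le P w K) -> sum_le P w K.
Proof.
move=> K0 H [|x0 s] us sP; first by rewrite big_nil.
by apply: (H x0) => //; apply: sP; rewrite mem_head.
Qed.

(** Pigeonhole: when [lo, lo + L] is cut into cells of length [q], no two points share a cell, and
    the cells that are met have indices 0, ..., floor (L / q). *)
Lemma count_spaced (T : eqType) (P : T -> Prop) (h : T -> R) lo L q :
  0 < q -> 0 <= L -> (forall x, P x -> lo <= h x <= lo + L) ->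
  (forall x y, P x -> P y -> x != y -> q <= `|h x - h y|) ->
  sum_le P (fun=> 1) (L / q + 1).
Proof.
move=> q0 L0 hb hs s us sP; rewrite big_const_seq count_predT iter_addr_0.
pose f x := Num.truncn ((h x - lo) / q).
have pos x : P x -> 0 <= (h x - lo) / q.
  by move=> /hb/andP[? ?]; rewrite divr_ge0 ?subr_ge0// ltW.
have uf : uniq (map f s).
  rewrite map_inj_in_uniq// => x y /sP Px /sP Py fxy.
  apply/eqP/negP => /negP xy; have := hs _ _ Px Py xy.
  have /andP[a1 a2] := truncn_itv (pos _ Px).
  have /andP[b1 b2] := truncn_itv (pos _ Py).
  rewrite -/(f x) -/(f y) -fxy in a1 a2 b1 b2.
  rewrite -natr1 in a2 b2.
  have E z : h z = (h z - lo) / q * q + lo by rewrite divfK ?gt_eqF// subrK.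
  rewrite leNgt => /negP; apply; rewrite (E x) (E y) opprD addrACA subrr addr0.
  rewrite -mulrBl normrM (gtr0_norm q0) gtr_pMl// ltr_norml; apply/andP; split; lra.
have : (size (map f s) <= size (iota 0 (Num.truncn (L / q)).+1))%N.
  apply: uniq_leq_size uf _ => _ /mapP[x /sP Px ->].
  rewrite mem_iota add0n ltnS/=; apply: le_truncn.
  by rewrite ler_pM2r ?invr_gt0//; have /andP[? ?] := hb _ Px; lra.
rewrite size_map size_iota => /(leq_trans)/(_ (leqnn _)) sz.
apply: le_trans (_ : ((Num.truncn (L / q)).+1%:R <= _)); first by rewrite ler_nat.
rewrite -natr1 lerD2r; have /andP[] // := truncn_itv (divr_ge0 L0 (ltW q0)).
Qed.

Lemma int_dist_ge1 (x y : int) : x != y -> 1 <= `|x%:~R - y%:~R| :> R.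
Proof.
move=> xy; rewrite -intrB -intr_norm -[1]/(1%:~R) ler_int; lia.
Qed.

(** All points lie within [L] of any one of them, hence in an interval of length 2 L, and distinct
    integers are at least 1 apart. *)
Lemma count_diam (P : int -> Prop) (L : R) : 0 <= L ->
  (forall x y, P x -> P y -> `|x%:~R - y%:~R| <= L) ->
  sum_le P (fun=> 1) (2 * L + 1).
Proof.
move=> L0 HL; apply: sum_le_nonempty => [|x0 Px0]; first lra.
rewrite -[2 * L]divr1.
apply: (@count_spaced _ _ (fun x : int => x%:~R : R) (x0%:~R - L)) => //.
- lra.
- by move=> x /HL - /(_ _ Px0); rewrite ler_distl => /andP[? ?]; apply/andP; split; lra.
- by move=> x y _ _; apply: int_dist_ge1.
Qed.

Definition nearz (c : int) (D : nat) (x : int) : bool := (absz (x - c) <= D)%N.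

Lemma count_nearz_spaced (T : eqType) (P : T -> Prop) (h : T -> int) c D (q : nat) :
  (0 < q)%N -> (forall x, P x -> nearz c D (h x)) ->
  (forall x y, P x -> P y -> x != y -> (q <= absz (h x - h y))%N) ->
  sum_le P (fun=> 1) (2 * D%:R / q%:R + 1).
Proof.
move=> q0 hb hs.
apply: (@count_spaced _ _ (fun x => (h x)%:~R) (c%:~R - D%:R)) => //.
- by rewrite ltr0n.
- move=> x /hb; rewrite /nearz => H.
  have : `|(h x - c)%:~R| <= D%:R :> R by rewrite -intr_norm -[D%:R]/(D%:Z%:~R) ler_int; lia.
  by rewrite intrB ler_distl => /andP[? ?]; apply/andP; split; lra.
- move=> x y Px Py /(hs _ _ Px Py) H.
  by rewrite -intrB -intr_norm -[q%:R]/(q%:Z%:~R) ler_int; lia.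
Qed.

Lemma count_nearz c D : sum_le (nearz c D) (fun=> 1) (2 * D%:R + 1).
Proof.
rewrite -[X in _ * X]divr1 mulrA.
apply: (@count_nearz_spaced _ _ id c D 1) => // x y _ _; lia.
Qed.

Lemma sum_le_prod (T U : eqType) (P : T -> Prop) (Q : U -> Prop) K1 K2 :
  0 <= K1 -> sum_le P (fun=> 1) K1 -> sum_le Q (fun=> 1) K2 ->
  sum_le (fun x : T * U => P x.1 /\ Q x.2) (fun=> 1) (K1 * K2).
Proof.
move=> K0 H1 H2.
apply: (@sum_le_fiber _ _ (fun x : T * U => x.2) Q _ (fun=> K1)) => [x []//|y Qy|].
  apply: (@sum_le_inj _ _ (fun x : T * U => x.1) P) H1 => //.
    by move=> x [[]].
  by move=> [x1 x2] [y1 y2] /= [_ ->] [_ ->] ->.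
exact: sum_le_cst.
Qed.

End SumLe.

(** * Lattice points on planes *)

Notation vec3 := (int * int * int)%type.

Lemma vec3_eq (x y : vec3) :
  x.1.1 = y.1.1 -> x.1.2 = y.1.2 -> x.2 = y.2 -> x = y.
Proof. by case: x y => [[? ?] ?] [[? ?] ?] /= -> -> ->. Qed.

Definition dot (p x : vec3) : int :=
  p.1.1 * x.1.1 + p.1.2 * x.1.2 + p.2 * x.2.

Definition supn (p : vec3) : nat :=
  maxn (maxn (absz p.1.1) (absz p.1.2)) (absz p.2).

Definition box (c : vec3) (D : nat) (x : vec3) : bool :=
  [&& nearz c.1.1 D x.1.1, nearz c.1.2 D x.1.2 & nearz c.2 D x.2].

Definition vgcd (p : vec3) : nat :=
  gcdn (gcdn (absz p.1.1) (absz p.1.2)) (absz p.2).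

Definition prim (p : vec3) : vec3 :=
  ((p.1.1 %/ vgcd p)%Z, (p.1.2 %/ vgcd p)%Z, (p.2 %/ vgcd p)%Z).

Lemma supn_eq0 p : (supn p == 0%N) = (p == 0).
Proof.
case: p => [[a b] c]; rewrite /supn /= -[(a, b, c) == 0]/((a == 0) && (b == 0) && (c == 0)).
lia.
Qed.

Lemma supn_gt0 p : (0 < supn p)%N = (p != 0).
Proof. by rewrite lt0n supn_eq0. Qed.

Lemma vgcd_gt0 p : p != 0 -> (0 < vgcd p)%N.
Proof.
case: p => [[a b] c]; rewrite -supn_gt0 /vgcd /supn /= !gcdn_gt0; lia.
Qed.

Lemma primE p : [/\ p.1.1 = (vgcd p)%:Z * (prim p).1.1,
  p.1.2 = (vgcd p)%:Z * (prim p).1.2 & p.2 = (vgcd p)%:Z * (prim p).2].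
Proof.
have d1 : ((vgcd p)%:Z %| p.1.1)%Z.
  by rewrite dvdzE /vgcd/= (dvdn_trans (dvdn_gcdl _ _))// dvdn_gcdl.
have d2 : ((vgcd p)%:Z %| p.1.2)%Z.
  by rewrite dvdzE /vgcd/= (dvdn_trans (dvdn_gcdl _ _))// dvdn_gcdr.
have d3 : ((vgcd p)%:Z %| p.2)%Z by rewrite dvdzE /vgcd/= dvdn_gcdr.
by split; rewrite /prim /= mulrC divzK.
Qed.

Lemma vgcd_prim p : p != 0 -> vgcd (prim p) = 1%N.
Proof.
move=> p0; have g0 := vgcd_gt0 p0; have [e1 e2 e3] := primE p.
apply/eqP; rewrite -(eqn_pmul2l g0) muln1; apply/eqP.
by rewrite {2}/vgcd !muln_gcdr {4}/vgcd e1 e2 e3 !abszM.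
Qed.

Lemma prim_neq0 p : p != 0 -> prim p != 0.
Proof.
move=> p0; apply/eqP => E; have := vgcd_prim p0.
by rewrite E /vgcd /= !gcdn0.
Qed.

Lemma dot_prim p x : dot p x = (vgcd p)%:Z * dot (prim p) x.
Proof. by rewrite /dot; have [-> -> ->] := primE p; rewrite /=; ring. Qed.

(** These involutions allow one to assume that the last coordinate has the largest modulus; any [i]
    above 1 gives the identity, for vectors where this holds already. *)
Definition cswap (i : nat) (v : vec3) : vec3 :=
  match i with
  | 0 => (v.2, v.1.2, v.1.1)
  | 1 => (v.1.1, v.2, v.1.2)
  | _ => v
  end.

Lemma cswapK i : involutive (cswap i).
Proof. by case: i => [|[|i]] [[? ?] ?]. Qed.

Lemma supn_cswap i v : supn (cswap i v) = supn v.
Proof. by case: i => [|[|i]]//; rewrite /supn /=; lia. Qed.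

Lemma box_cswap i c D v : box (cswap i c) D (cswap i v) = box c D v.
Proof. by case: i => [|[|i]]//; rewrite /box /=; do 3 case: nearz. Qed.

Lemma dot_cswap i p v : dot (cswap i p) (cswap i v) = dot p v.
Proof. by case: i => [|[|i]]//; rewrite /dot /=; ring. Qed.

Lemma vgcd_cswap i p : vgcd (cswap i p) = vgcd p.
Proof.
case: i => [|[|i]]//; rewrite /vgcd /=.
  by rewrite gcdnC [gcdn (absz p.2) _]gcdnC gcdnA.
by rewrite -!gcdnA [gcdn (absz p.2) _]gcdnC.
Qed.

Lemma cswapB i x y : cswap i (x - y) = cswap i x - cswap i y.
Proof. by case: i => [|[|i]]. Qed.

Lemma cswap_max v : exists i, absz (cswap i v).2 = supn v.
Proof.
have : [\/ absz v.1.1 = supn v, absz v.1.2 = supn v | absz v.2 = supn v].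
  have [E1|E1] := eqVneq (absz v.1.1) (supn v); first by constructor 1.
  have [E2|E2] := eqVneq (absz v.1.2) (supn v); first by constructor 2.
  by constructor 3; move: E1 E2; rewrite /supn; lia.
by case=> E; [exists 0%N | exists 1%N | exists 2%N].
Qed.

Section Plane.
Variable R : archiRealFieldType.
Implicit Types (P : vec3 -> Prop) (c p x y : vec3).

(* With h = gcd(p.1.2, p.2), the coordinate x.1.1 is fixed modulo h, then x.1.2
   modulo |p.2| / h, and x.2 follows. *)
Let plane_last P c p (D : nat) : (0 < D)%N -> p.2 != 0 -> vgcd p = 1%N ->
  (forall x, P x -> box c D x) ->
  (forall x y, P x -> P y -> dot p (x - y) = 0) ->
  sum_le P (fun=> 1 : R) (4 * D%:R ^+ 2 / (absz p.2)%:R + 5 * D%:R).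
Proof.
move=> D0 p3 cop Pb Pd.
have absz_gt0 : (0 < absz p.2)%N by lia.
pose h := gcdn (absz p.1.2) (absz p.2).
have h0 : (0 < h)%N by rewrite gcdn_gt0 absz_gt0 orbT.
pose k := (absz p.2 %/ h)%N.
have qE : absz p.2 = (k * h)%N by rewrite divnK ?dvdn_gcdr.
have k0 : (0 < k)%N by move: absz_gt0; rewrite qE muln_gt0 => /andP[].
have cop1 : coprime h (absz p.1.1).
  by rewrite /coprime gcdnC gcdnA -/(vgcd p) cop.
(* For two points of the plane, [h] divides p.1.1 times the difference of the first coordinates, and
   [h] is prime to p.1.1 because gcd(p) = 1. *)
have b1 : sum_le (fun t => exists2 x, P x & x.1.1 = t) (fun=> 1 : R)
    (2 * D%:R / h%:R + 1).
  apply: (@count_nearz_spaced _ _ _ id c.1.1) => //.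
    by move=> _ [x /Pb/and3P[? ? ?] <-].
  move=> _ _ [x Px <-] [y Py <-] /= xy; apply: dvdn_leq; first by lia.
  rewrite -(Gauss_dvdr _ cop1) -abszM.
  have -> : p.1.1 * (x.1.1 - y.1.1) = - (p.1.2 * (x.1.2 - y.1.2) + p.2 * (x.2 - y.2)).
    by have := Pd _ _ Px Py; rewrite /dot /=; lia.
  rewrite abszN -[X in (X %| _)%N]/(absz h%:Z) -dvdzE rpredD//.
    by rewrite dvdz_mulr// dvdzE dvdn_gcdl.
  by rewrite dvdz_mulr// dvdzE dvdn_gcdr.
(* Once x.1.1 is fixed, the equation of the plane divided by [h] has the coprime coefficients p.1.2
   / h and, up to sign, k; hence [k] divides the difference of the second coordinates. *)
have b2 t : sum_le (fun x => P x /\ x.1.1 = t) (fun=> 1 : R)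
    (2 * D%:R / k%:R + 1).
  apply: (@count_nearz_spaced _ _ _ (fun x => x.1.2) c.1.2) => //.
    by move=> x [/Pb/and3P[? ? ?] _].
  move=> x y [Px xt] [Py yt] xy.
  have E : p.1.2 * (x.1.2 - y.1.2) = - (p.2 * (x.2 - y.2)).
    by have := Pd _ _ Px Py; rewrite /dot /= xt yt; lia.
  apply: dvdn_leq.
    rewrite lt0n absz_eq0 subr_eq0; apply: contraNN xy => /eqP e2.
    have e3 : x.2 = y.2.
      apply/eqP; move/eqP: E; rewrite e2 subrr mulr0 eq_sym oppr_eq0 mulf_eq0.
      by rewrite (negbTE p3)/= subr_eq0.
    by apply/eqP/vec3_eq => //; rewrite xt yt.
  have cop2 : coprime k (absz p.1.2 %/ h).
    rewrite /coprime -(eqn_pmul2l h0) muln1 muln_gcdr ![(h * _)%N]mulnC -qE.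
    by rewrite divnK ?dvdn_gcdl// gcdnC.
  rewrite -(Gauss_dvdr _ cop2) -(dvdn_pmul2r h0) -qE mulnAC divnK ?dvdn_gcdl//.
  by rewrite -abszM E abszN abszM dvdn_mulr.
have h1 : 1 <= h%:R :> R by rewrite ler1n.
have k1 : 1 <= k%:R :> R by rewrite ler1n.
have D1 : 1 <= D%:R :> R by rewrite ler1n.
(* Each of the two cross terms is at most 2 d and the final 1 is at most d, whence the coefficient
   5. *)
have key (d a b : R) : 1 <= a -> 1 <= b -> 1 <= d ->
    (2 * d / b + 1) * (2 * d / a + 1) <= 4 * d ^+ 2 / (b * a) + 5 * d.
  move=> a1 b1' d1.
  have -> : 4 * d ^+ 2 / (b * a) = (2 * d / b) * (2 * d / a).
    by field; apply/andP; split; apply/eqP; lra.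
  have l1 : 2 * d / b <= 2 * d by rewrite ler_pdivrMr; nra.
  have l2 : 2 * d / a <= 2 * d by rewrite ler_pdivrMr; nra.
  by rewrite mulrDl mulrDr; lra.
apply: (sum_le_mono (w' := fun=> 1) (P' := P)
    (K' := (2 * D%:R / k%:R + 1) * (2 * D%:R / h%:R + 1))) => //.
- by rewrite qE natrM; apply: key.
- apply: (sum_le_fiber (f := fun x => x.1.1) (Q := fun t => exists2 x, P x & x.1.1 = t)
    (w' := fun=> 2 * D%:R / k%:R + 1)) => [x Px|t _|]; first by exists x.
    exact: b2.
  by apply: sum_le_cst b1 => //; rewrite addr_ge0// divr_ge0// mulr_ge0.
Qed.

(** A permutation of the coordinates leaves the scalar product and the gcd unchanged and moves an
    entry of modulus [supn p] to the last place, where [plane_last] applies. *)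
Lemma count_plane P c p (D : nat) : (0 < D)%N -> p != 0 -> vgcd p = 1%N ->
  (forall x, P x -> box c D x) ->
  (forall x y, P x -> P y -> dot p (x - y) = 0) ->
  sum_le P (fun=> 1 : R) (4 * D%:R ^+ 2 / (supn p)%:R + 5 * D%:R).
Proof.
move=> D0 p0 cop Pb Pd; move: (p0); rewrite -supn_gt0 => s0.
have [i E] := cswap_max p.
apply: (sum_le_inj (f := cswap i) (w' := fun=> 1) (Q := fun v => P (cswap i v))).
- by move=> x; rewrite cswapK.
- by [].
- by move=> x y _ _; apply: (can_inj (cswapK i)).
rewrite -E; apply: (plane_last (c := cswap i c)) => //; first lia.
- by rewrite vgcd_cswap.
- by move=> x /Pb; rewrite -(box_cswap i) cswapK.
- by move=> x y Px Py; rewrite -(dot_cswap i) cswapK cswapB; apply: Pd.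
Qed.

End Plane.

(** * Sums of the inverse sizes of primitive normals *)

Section Weights.
Variable R : archiRealFieldType.
Implicit Types (P : vec3 -> Prop) (c p x y : vec3).

(** A coordinate of largest modulus sits in one of three places; ties are harmless, as the first
    place that works is taken. *)
Lemma sum_le_cswap P (w : vec3 -> R) K :
  (forall i, sum_le (fun v => P (cswap i v) /\ absz v.2 = supn v)
    (fun v => w (cswap i v)) K) -> sum_le P w (3 * K).
Proof.
move=> H.
have H' i : sum_le (fun v => P v /\ absz (cswap i v).2 = supn v) w K.
  apply: sum_le_inj (H i) => [v [Pv E]|v _|x y _ _]; last exact: (can_inj (cswapK i)).
    by rewrite cswapK supn_cswap.
  by rewrite cswapK.
have -> : 3 * K = K + (K + K) by ring.
apply: (@sum_le_split _ _ (fun v => absz (cswap 0 v).2 == supn v)).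
  by apply: sum_le_mono (H' 0%N) => // v [Pv /eqP].
apply: (@sum_le_split _ _ (fun v => absz (cswap 1 v).2 == supn v)).
  by apply: sum_le_mono (H' 1%N) => // v [[Pv _] /eqP].
apply: sum_le_mono (H' 2%N) => // v [[Pv /eqP E1] /eqP E2]; split => //.
by have := cswap_max v; move: E1 E2; rewrite /supn /=; lia.
Qed.

Lemma count_box c D : sum_le (box c D) (fun=> 1) ((2 * D%:R + 1) ^+ 3 : R).
Proof.
have d0 : 0 <= 2 * D%:R + 1 :> R by rewrite addr_ge0// mulr_ge0.
rewrite exprS expr2 mulrA.
have H3 := sum_le_prod d0 (@count_nearz R c.1.1 D) (@count_nearz R c.1.2 D).
have := sum_le_prod (mulr_ge0 d0 d0) H3 (@count_nearz R c.2 D).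
by apply: sum_le_mono => // v /and3P[].
Qed.

(* A primitive p' with |p'| <= B has at most 2 B / |p'| + 1 multiples in the box;
   the other points number O(B^3) and weigh less than 1 / B each. *)
Lemma sum_inv_prim c (B : nat) : (0 < B)%N ->
  sum_le (fun p => p != 0 /\ box c B p)
    (fun p => ((supn (prim p))%:R)^-1) (270 * B%:R ^+ 2 : R).
Proof.
move=> B0; have B1 : 1 <= B%:R :> R by rewrite ler1n.
have -> : 270 * B%:R ^+ 2 = 243 * B%:R ^+ 2 + B%:R^-1 * (27 * B%:R ^+ 3) :> R.
  by rewrite -[B%:R ^+ 3]mulr1; field; apply/eqP; lra.
apply: (@sum_le_split _ _ (fun p => (supn (prim p) <= B)%N)); last first.
  apply: (sum_le_cst (P := fun p => (p != 0 /\ box c B p) /\ ~~ (supn (prim p) <= B)%N)).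
  - by rewrite invr_ge0.
  - move=> p [_]; rewrite -ltnNge => lt.
    by rewrite lef_pV2 ?ler_nat ?(ltnW lt)// posrE ltr0n// (leq_trans _ lt).
  - apply: sum_le_mono (@count_box c B) => [v [[]]//|//|].
    have -> : 27 * B%:R ^+ 3 = (3 * B%:R) ^+ 3 :> R by ring.
    by rewrite lerXn2r ?nnegrE//; lra.
(* The weight 1 / |y| times a bound for the number of points of the cube with primitive part y.
   These are multiples of y, so their coordinates at the place where |y| is attained are spaced by
   |y|. *)
pose w' (y : vec3) : R := (supn y)%:R^-1 * (2 * B%:R / (supn y)%:R + 1).
apply: (@sum_le_fiber _ _ _ prim (fun y => y != 0 /\ (supn y <= B)%N) _ w').
- by move=> p [[/prim_neq0 ? _] ?].
- move=> y [y0 yB]; apply: sum_le_cst; first by rewrite invr_ge0.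
    by move=> p [_ ->].
  have [i iy] := cswap_max y.
  apply: (@count_nearz_spaced _ _ _ (fun x => (cswap i x).2) (cswap i c).2).
  + by rewrite supn_gt0.
  + by move=> x [[[_ +] _] _]; rewrite -(box_cswap i) => /and3P[].
  + move=> x z [_ xy] [_ zy] xz; have [e1 e2 e3] := primE x.
    have [f1 f2 f3] := primE z; rewrite xy in e1 e2 e3; rewrite zy in f1 f2 f3.
    have -> : (cswap i x).2 = (vgcd x)%:Z * (cswap i y).2.
      by case: i {iy} => [|[|i]].
    have -> : (cswap i z).2 = (vgcd z)%:Z * (cswap i y).2.
      by case: i {iy} => [|[|i]].
    rewrite -mulrBl abszM iy leq_pmull// absz_gt0 subr_eq0.
    apply: contraNneq xz => E; apply/eqP/vec3_eq; by rewrite ?(e1, e2, e3, f1, f2, f3) E.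
(* The factor 3 is for the place of the largest coordinate t of y, and 3 B bounds the number of
   values of t. For each t there are at most 9 t^2 vectors of weight (2 B / |t| + 1) / |t|, which
   makes at most 27 B. *)
have -> : 243 * B%:R ^+ 2 = 3 * (27 * B%:R * (3 * B%:R)) :> R by ring.
apply: sum_le_cswap => i.
apply: (@sum_le_fiber _ _ _ (fun v : vec3 => v.2) (fun t => nearz 0 B t /\ t != 0) _
  (fun=> 27 * B%:R)).
- move=> v [[v0 vB] E]; rewrite /nearz subr0 E -(supn_cswap i) vB; split => //.
  by rewrite -absz_gt0 E -(supn_cswap i) supn_gt0.
- move=> t []; rewrite /nearz subr0 => tB t0.
  have t1 : 1 <= (absz t)%:R :> R by rewrite ler1n absz_gt0.
  have tB' : (absz t)%:R <= B%:R :> R by rewrite ler_nat.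
  pose T : R := (absz t)%:R; rewrite -/T in t1 tB'.
  apply: (@sum_le_mono _ _ _ (fun v : vec3 => supn v = absz t /\ v.2 = t) _
    (fun=> T^-1 * (2 * B%:R / T + 1)) _
    (T^-1 * (2 * B%:R / T + 1) * ((2 * T + 1) * (2 * T + 1)))).
  + by move=> v [[_ <-] <-].
  + by move=> v [[_ E] vt]; rewrite /w' supn_cswap -E vt.
  + have : (2 * T + 1) * (2 * T + 1) <= 9 * T ^+ 2 by nra.
    have p0 : 0 <= T^-1 * (2 * B%:R / T + 1).
      by rewrite mulr_ge0 ?invr_ge0 ?addr_ge0 ?divr_ge0//; lra.
    move/(ler_wpM2l p0) => /le_trans; apply.
    have -> : T^-1 * (2 * B%:R / T + 1) * (9 * T ^+ 2) = 18 * B%:R + 9 * T.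
      by field; apply/eqP; lra.
    lra.
  + apply: sum_le_cst => //.
      by rewrite mulr_ge0 ?invr_ge0 ?addr_ge0 ?divr_ge0//; lra.
    have d0 : 0 <= 2 * T + 1 by lra.
    apply: (sum_le_inj (f := fst) (w' := fun=> 1)); last first.
      exact: (sum_le_prod d0 (@count_nearz R 0 (absz t)) (@count_nearz R 0 (absz t))).
    * by move=> [[? ?] ?] [[? ?] ?] [_ /= ->] [_ /= ->] [-> ->].
    * by [].
    * by move=> v [E _]; move: E; rewrite /nearz /supn /= !subr0 => <-; split; lia.
- apply: sum_le_cst => //.
  by apply: sum_le_mono (@count_nearz R 0 B) => [? []|//|]//; lra.
Qed.

End Weights.

(** * Resonant pairs *)

Section Pairs.
Variable R : archiRealFieldType.
Implicit Types (c p : vec3).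

(** By [count_plane] the points [x] over a given [p] number at most 4 A^2 / |p'| + 5 A. The first
    term is summed by [sum_inv_prim], with 1080 = 4 * 270; the second is multiplied by the number of
    normals, for which [Q] records what is known about them. *)
Lemma count_pairs (P : vec3 * vec3 -> Prop) (Q : vec3 -> Prop) c
    (c' : vec3 -> vec3) (A B : nat) (K : R) : (0 < A)%N -> (0 < B)%N ->
  (forall p x, P (p, x) -> [/\ Q p, p != 0, box c B p & box (c' p) A x]) ->
  (forall p x y, P (p, x) -> P (p, y) -> dot p (x - y) = 0) ->
  sum_le Q (fun=> 1) (K * A%:R * B%:R ^+ 2) ->
  sum_le P (fun=> 1) ((1080 + 5 * K) * A%:R ^+ 2 * B%:R ^+ 2).
Proof.
move=> A0 B0 PQ Pd HQ.
have -> : (1080 + 5 * K) * A%:R ^+ 2 * B%:R ^+ 2 =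
    4 * A%:R ^+ 2 * (270 * B%:R ^+ 2) + 5 * A%:R * (K * A%:R * B%:R ^+ 2).
  by ring.
apply: (@sum_le_fiber _ _ _ fst (fun p => [/\ Q p, p != 0 & box c B p]) _
  (fun p => 4 * A%:R ^+ 2 * (supn (prim p))%:R^-1 + 5 * A%:R * 1)).
- by move=> [p x] /PQ[].
- move=> p [_ p0 _]; rewrite mulr1.
  apply: (@sum_le_inj _ _ _ snd (fun x => P (p, x)) _ (fun=> 1)) => //.
  + by move=> [q x] [+ /= <-].
  + by move=> [q x] [q' x'] [_ /= ->] [_ /= ->] ->.
  apply: (@count_plane _ _ (c' p)) => //.
  + exact: prim_neq0.
  + exact: vgcd_prim.
  + by move=> x /PQ[].
  + move=> x y Px Py; have := Pd _ _ _ Px Py; rewrite dot_prim => /eqP.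
    rewrite mulf_eq0 => /orP[|/eqP//].
    by have := vgcd_gt0 p0; case: vgcd.
- apply: sum_leD; apply: sum_leZ => //.
  + by apply: sum_le_mono (@sum_inv_prim R c B B0) => // p [].
  + by apply: sum_le_mono HQ => // p [].
Qed.

(** At most 9 D^2 points have a maximum above D, and each of them weighs at most 1 / D. Among the
    others, those with a given value t of the dominant coordinate weigh at most 3 together, t takes
    at most 3 D values, and there are two choices of dominant coordinate. *)
Lemma sum_inv_max2 (c1 c2 : int) (D : nat) : (0 < D)%N ->
  sum_le (fun x : int * int => nearz c1 D x.1 /\ nearz c2 D x.2)
    (fun x => (maxn 1 (maxn (absz x.1) (absz x.2)))%:R^-1) (27 * D%:R : R).
Proof.
move=> D0; have D1 : 1 <= D%:R :> R by rewrite ler1n.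
have half (f : int * int -> int * int) : injective f ->
    (forall x, maxn (absz (f x).1) (absz (f x).2) = maxn (absz x.1) (absz x.2)) ->
    sum_le (fun x : int * int => (absz (f x).2 <= absz (f x).1 <= D)%N)
      (fun x => (maxn 1 (maxn (absz x.1) (absz x.2)))%:R^-1) (9 * D%:R : R).
  move=> fI fm.
  apply: (@sum_le_fiber _ _ _ (fun x => (f x).1) (nearz 0 D) _ (fun=> 3)).
  - by move=> x /andP[_]; rewrite /nearz subr0.
  - move=> t _.
    pose T : R := (maxn 1 (absz t))%:R.
    have T1 : 1 <= T by rewrite ler1n leq_maxl.
    apply: (@sum_le_mono _ _ _ (fun x => (absz (f x).2 <= absz t)%N /\ (f x).1 = t) _
      (fun=> T^-1) _ (T^-1 * (2 * T + 1))).
    + by move=> x [/andP[+ _] <-].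
    + move=> x [/andP[le _] xt]; rewrite -fm (_ : maxn (absz (f x).1) _ = absz t)//.
      by rewrite xt in le *; lia.
    + have TV : T^-1 <= 1 by rewrite invf_le1//; lra.
      rewrite mulrDr mulr1 mulrCA mulVf; first lra.
      by rewrite gt_eqF//; lra.
    + apply: sum_le_cst => //; first by rewrite invr_ge0; lra.
      apply: (@sum_le_inj _ _ _ (fun x => (f x).2) (nearz 0 (absz t)) _ (fun=> 1)) => //.
      * by move=> x [+ _]; rewrite /nearz subr0.
      * by move=> x y [_ e1] [_ e2] e3; apply: fI; rewrite [LHS]surjective_pairing e1 -e2 e3 -surjective_pairing.
      * apply: sum_le_mono (@count_nearz R 0 (absz t)) => //.
        by rewrite lerD2r ler_wpM2l// ler_nat leq_maxr.
  - apply: (@sum_le_mono _ _ _ (nearz 0 D) _ (fun=> 3) _ (3 * (2 * D%:R + 1))) => //.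
      lra.
    by apply: sum_le_cst => //; exact: count_nearz.
have -> : 27 * D%:R = D%:R^-1 * (9 * D%:R ^+ 2) + (9 * D%:R + 9 * D%:R) :> R.
  by field; apply/eqP; lra.
apply: (@sum_le_split _ _ (fun x => D < maxn (absz x.1) (absz x.2))%N).
  apply: (sum_le_cst (P := fun x => (nearz c1 D x.1 /\ nearz c2 D x.2) /\ (D < maxn (absz x.1) (absz x.2))%N)).
  - by rewrite invr_ge0.
  - by move=> x [_ ?]; rewrite lef_pV2 ?ler_nat ?posrE ?ltr0n; lia.
  - have d0 : 0 <= 2 * D%:R + 1 :> R by lra.
    apply: sum_le_mono (sum_le_prod d0 (@count_nearz R c1 D) (@count_nearz R c2 D)) => //.
      by move=> x [].
    nra.
apply: (@sum_le_split _ _ (fun x => absz x.2 <= absz x.1)%N).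
  apply: sum_le_mono (half id _ _) => //.
  by move=> x [[_ +] +] /=; rewrite -leqNgt geq_max => /andP[-> _] ->.
apply: sum_le_mono (half (fun x => (x.2, x.1)) _ _) => //=.
- by move=> x [[_ +] +] /=; rewrite -leqNgt -ltnNge geq_max => /andP[_ ->] /ltnW ->.
- by move=> [? ?] [? ?] [-> ->].
- by move=> x; rewrite maxnC.
Qed.

(* Splitting by the largest coordinate and its sign, that coordinate t satisfies
   |t - t'| <= H / |t + t'| along a fibre, and |t + t'| dominates the others. *)
Lemma count_shell (P : vec3 -> Prop) c (D H : nat) : (0 < D)%N ->
  (forall z, P z -> box c D z) ->
  (forall z w, P z -> P w -> (absz (dot z z - dot w w) <= H)%N) ->
  sum_le P (fun=> 1) (324 * H%:R * D%:R + 54 * D%:R ^+ 2 : R).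
Proof.
move=> D0 Pb Ps; have D1 : 1 <= D%:R :> R by rewrite ler1n.
have -> : 324 * H%:R * D%:R + 54 * D%:R ^+ 2 =
    3 * ((54 * H%:R * D%:R + 9 * D%:R ^+ 2) + (54 * H%:R * D%:R + 9 * D%:R ^+ 2)) :> R.
  by ring.
apply: sum_le_cswap => i.
have half (b : pred int) : (forall s t, b s -> b t -> 0 <= s * t) ->
   sum_le (fun z => (P (cswap i z) /\ absz z.2 = supn z) /\ b z.2) (fun=> 1)
     (54 * H%:R * D%:R + 9 * D%:R ^+ 2 : R).
  move=> bs; pose m (x : int * int) : R := (maxn 1 (maxn (absz x.1) (absz x.2)))%:R.
  have m1 x : 1 <= m x by rewrite ler1n leq_maxl.
  apply: (@sum_le_fiber _ _ _ fst
    (fun x => nearz (cswap i c).1.1 D x.1 /\ nearz (cswap i c).1.2 D x.2) _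
    (fun x => 2 * H%:R * (m x)^-1 + 1)).
  - by move=> z [[/Pb + _] _]; rewrite -(box_cswap i) cswapK => /and3P[].
  - move=> y _; rewrite -mulrA.
    apply: (@sum_le_inj _ _ _ snd
      (fun t => [/\ P (cswap i (y, t)), absz t = supn (y, t) & b t]) _ (fun=> 1)) => //.
    + by move=> [x t] [[[? ?] ?] /= <-].
    + by move=> [x t] [x' t'] [_ /= ->] [_ /= ->] ->.
    apply: count_diam => [|s t [Pt ms bb] [Pt' mt bt]].
      by rewrite divr_ge0//; have := m1 y; lra.
    have [->|st] := eqVneq s t.
      by rewrite subrr normr0 divr_ge0//; have := m1 y; lra.
    rewrite ler_pdivlMr; last by have := m1 y; lra.
    rewrite -intrB -intr_norm -[m y]/((maxn 1 (maxn (absz y.1) (absz y.2)))%:Z%:~R) -intrM.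
    rewrite -[H%:R]/(H%:Z%:~R) ler_int.
    have := Ps _ _ Pt Pt'; rewrite !dot_cswap /dot /= => Hh.
    have S : absz (s * s - t * t)%R = (absz (s - t)%R * absz (s + t)%R)%N.
      by rewrite -abszM; congr absz; ring.
    have {}Hh : (absz (s - t)%R * absz (s + t)%R <= H)%N.
      by rewrite -S; move: Hh; rewrite opprD addrACA subrr add0r.
    (* As [s] and [t] do not have opposite signs, |s + t| = |s| + |t|. This dominates the other
       coordinates, since |s| is the largest one, and it is at least 1 because s and t differ. *)
    have ge : (maxn 1 (maxn (absz y.1) (absz y.2)) <= absz (s + t)%R)%N.
      have -> : absz (s + t)%R = (absz s + absz t)%N.
        by move: (bs _ _ bb bt); case: (lerP 0 s); case: (lerP 0 t); nia.
      move: ms; rewrite /supn /=; move: (absz y.1) (absz y.2) => u v.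
      by move: st; lia.
    apply: le_trans (_ : (absz (s - t)%R * absz (s + t)%R)%N%:Z <= _); last by [].
    by rewrite PoszM -abszE ler_wpM2l.
  - apply: (@sum_le_mono _ _ _ (fun x => nearz (cswap i c).1.1 D x.1 /\ nearz (cswap i c).1.2 D x.2) _
     (fun x => 2 * H%:R * (m x)^-1 + 1) _ (2 * H%:R * (27 * D%:R) + (2 * D%:R + 1) * (2 * D%:R + 1))) => //.
      nra.
    apply: sum_leD.
      by apply: sum_leZ; [rewrite mulr_ge0 | exact: sum_inv_max2].
    have d0 : 0 <= 2 * D%:R + 1 :> R by lra.
    exact: (sum_le_prod d0 (@count_nearz R _ D) (@count_nearz R _ D)).
apply: (@sum_le_split _ _ (fun z => 0 <= z.2)).
  by apply: (half (fun t => 0 <= t)) => s t; exact: mulr_ge0.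
apply: sum_le_mono (half (fun t => t <= 0) _) => //.
- by move=> z [? +]; rewrite -ltNge => /ltW.
- by move=> s t; exact: mulr_le0.
Qed.

End Pairs.

Section Resonance.
Variable R : archiRealFieldType.
Implicit Types (nu n : vec3) (tau kappa : int) (A B : nat).

Lemma box_supn n A : (supn n <= A)%N -> box 0 A n.
Proof. by rewrite /box /nearz /supn !subr0 !geq_max -andbA. Qed.

Lemma absz_dot_le (p n : vec3) : (absz (dot p n) <= 3 * supn p * supn n)%N.
Proof.
have H (a b : int) : (absz a <= supn p)%N -> (absz b <= supn n)%N ->
    (absz (a * b)%R <= supn p * supn n)%N by rewrite abszM => *; exact: leq_mul.
have h1 : (absz (p.1.1 * n.1.1)%R <= supn p * supn n)%N by apply: H; rewrite /supn; lia.
have h2 : (absz (p.1.2 * n.1.2)%R <= supn p * supn n)%N by apply: H; rewrite /supn; lia.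
have h3 : (absz (p.2 * n.2)%R <= supn p * supn n)%N by apply: H; rewrite /supn; lia.
by rewrite /dot; lia.
Qed.

Lemma supnB_le (p n : vec3) : (supn (p - n)%R <= supn p + supn n)%N.
Proof.
have H (a b : int) : (absz a <= supn p)%N -> (absz b <= supn n)%N ->
    (absz (a - b)%R <= supn p + supn n)%N by lia.
rewrite {1}/supn !geq_max -andbA; apply/and3P; split.
- by apply: (H p.1.1 n.1.1); rewrite /supn; lia.
- by apply: (H p.1.2 n.1.2); rewrite /supn; lia.
- by apply: (H p.2 n.2); rewrite /supn; lia.
Qed.

Lemma count_box_cube c B : (0 < B)%N ->
  sum_le (box c B) (fun=> 1) (27 * B%:R ^+ 3 : R).
Proof.
move=> B0; have B1 : 1 <= B%:R :> R by rewrite ler1n.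
apply: sum_le_mono (@count_box R c B) => //.
have -> : 27 * B%:R ^+ 3 = (3 * B%:R) ^+ 3 :> R by ring.
by rewrite lerXn2r ?nnegrE//; lra.
Qed.

(** The relation is symmetric, so the entry in the smaller cube may serve as the normal: p = n2 -
    nu. There are at most 27 B^3 <= 27 A B^2 such normals, hence K = 27 in [count_pairs]. *)
Lemma count_resonant12 nu kappa A B : (0 < A)%N -> (0 < B)%N ->
  sum_le (fun z : vec3 * vec3 => [/\ 2 * dot (z.1 - nu) (z.2 - nu) = kappa,
      z.1 != nu, z.2 != nu, (supn z.1 <= A)%N & (supn z.2 <= B)%N])
    (fun=> 1) (1215 * A%:R ^+ 2 * B%:R ^+ 2 : R).
Proof.
wlog AB : A B / (B <= A)%N.
  move=> H A0 B0; have [/H|/ltnW/H H'] := leqP B A; first exact.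
  apply: (@sum_le_inj _ _ _ (fun z : vec3 * vec3 => (z.2, z.1))
    (fun z => [/\ 2 * dot (z.1 - nu) (z.2 - nu) = kappa,
      z.1 != nu, z.2 != nu, (supn z.1 <= B)%N & (supn z.2 <= A)%N]) _ (fun=> 1)).
  - by move=> z [<- ? ? ? ?]; split => //=; rewrite /dot; ring.
  - by [].
  - by move=> [? ?] [? ?] _ _ [-> ->].
  - by rewrite mulrAC; exact: H'.
move=> A0 B0; have B1 : 1 <= B%:R :> R by rewrite ler1n.
have BA : B%:R <= A%:R :> R by rewrite ler_nat.
pose P (z : vec3 * vec3) := [/\ 2 * dot (z.2 - nu) z.1 = kappa,
      z.1 != 0, z.2 != nu, (supn z.2 <= A)%N & (supn (z.1 + nu)%R <= B)%N].
apply: (@sum_le_inj _ _ _ (fun z : vec3 * vec3 => (z.2 - nu, z.1)) P _ (fun=> 1)).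
- by move=> z [? ? ? ? ?]; split => //=; rewrite ?subr_eq0 ?subrK.
- by [].
- by move=> [? ?] [? ?] _ _ E; move: (congr1 fst E) (congr1 snd E) => /= /addIr -> ->.
have -> : 1215 * A%:R ^+ 2 * B%:R ^+ 2 = (1080 + 5 * 27) * A%:R ^+ 2 * B%:R ^+ 2 :> R by ring.
apply: (@count_pairs _ _ (box (- nu) B) (- nu) (fun=> 0)) => //.
- move=> p x [_ p0 _ xA pB]; have pb : box (- nu) B p.
    by have := box_supn pB; rewrite /box /nearz /= !subr0 !opprK.
  by split => //; exact: box_supn.
- move=> p x y [+ _ _ _ _] [+ _ _ _ _] /=; rewrite /dot /=; lia.
- apply: sum_le_mono (@count_box_cube (- nu) B B0) => //.
  by rewrite exprS mulrA ler_wpM2r ?exprn_ge0// ler_wpM2l.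
Qed.

(** The pair is (n2, n3), and n3 - n2 stands for n1 - nu. For B <= A the normal is n2 - nu and n3
    lies on the plane; for A <= B the normal is n2 - n3. *)
Lemma count_resonant23 nu kappa A B : (0 < A)%N -> (0 < B)%N ->
  sum_le (fun z : vec3 * vec3 => [/\ 2 * dot (z.2 - z.1) (z.1 - nu) = kappa,
      z.1 != nu, z.1 != z.2, (supn z.1 <= B)%N & (supn z.2 <= A)%N])
    (fun=> 1) (320 * 1000 * A%:R ^+ 2 * B%:R ^+ 2 : R).
Proof.
move=> A0 B0; have B1 : 1 <= B%:R :> R by rewrite ler1n.
have A1 : 1 <= A%:R :> R by rewrite ler1n.
have AB0 : 0 <= A%:R ^+ 2 * B%:R ^+ 2 :> R by rewrite mulr_ge0 ?exprn_ge0.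
have [BA|/ltnW AB] := leqP B A.
  pose P (z : vec3 * vec3) := [/\ 2 * dot (z.2 - (z.1 + nu)) z.1 = kappa,
      z.1 != 0, (supn (z.1 + nu)%R <= B)%N & (supn z.2 <= A)%N].
  apply: (@sum_le_inj _ _ _ (fun z : vec3 * vec3 => (z.1 - nu, z.2)) P _ (fun=> 1)).
  - by move=> z [? ? ? ? ?]; split => //=; rewrite ?subr_eq0 ?subrK.
  - by [].
  - by move=> [? ?] [? ?] _ _ E; move: (congr1 fst E) (congr1 snd E) => /= /addIr -> ->.
  have BA' : B%:R <= A%:R :> R by rewrite ler_nat.
  apply: (@sum_le_mono _ _ _ P _ (fun=> 1) _ ((1080 + 5 * 27) * A%:R ^+ 2 * B%:R ^+ 2)) => //.
    by rewrite -!mulrA; lra.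
  apply: (@count_pairs _ _ (box (- nu) B) (- nu) (fun=> 0)) => //.
  - move=> p x [_ p0 pB xA]; have pb : box (- nu) B p.
      by have := box_supn pB; rewrite /box /nearz /= !subr0 !opprK.
    by split => //; exact: box_supn.
  - move=> p x y [+ _ _ _] [+ _ _ _] /=; rewrite /dot /=; lia.
  - apply: sum_le_mono (@count_box_cube (- nu) B B0) => //.
    by rewrite exprS mulrA ler_wpM2r ?exprn_ge0// ler_wpM2l.
(* For m = n2 - n3, the bound |2 m . (nu - m) - kappa| = |2 m . n3| <= 12 A B
   places 2 m - nu in a thin spherical shell. *)
pose P (z : vec3 * vec3) := [/\ 2 * dot (- z.1) (z.1 + z.2 - nu) = kappa,
      z.1 != 0, (supn z.1 <= 2 * B)%N & (supn z.2 <= A)%N].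
apply: (@sum_le_inj _ _ _ (fun z : vec3 * vec3 => (z.1 - z.2, z.2)) P _ (fun=> 1)).
- move=> z [? ? ? hB hA]; split => //=; rewrite ?opprB ?subr_eq0 ?subrK//.
  by rewrite (leq_trans (supnB_le _ _))// mul2n -addnn leq_add// (leq_trans hA).
- by [].
- move=> [a b] [a' b'] _ _ E; have e2 : b = b' := congr1 snd E.
  have e1 : a - b = a' - b' := congr1 fst E.
  by rewrite e2 in e1 *; move/addIr: e1 => ->.
(* The shell count below yields at most 62208 A B^2 + 864 B^2 <= 63072 A B^2 normals, and 63072 = 4
   * 12 * 1314, the 4 coming from the side 2 B. *)
apply: (@sum_le_mono _ _ _ P _ (fun=> 1) _
  ((1080 + 5 * (12 * 1314)) * A%:R ^+ 2 * (2 * B)%:R ^+ 2)) => //.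
  have E (c a b : R) : c * a * (2 ^+ 2 * b) = c * 4 * (a * b) by ring.
  by rewrite natrM exprMn E -[leRHS]mulrA ler_wpM2r//; lra.
pose Q (m : vec3) := (supn m <= 2 * B)%N /\ (absz (2 * dot m (nu - m) - kappa)%R <= 12 * (A * B))%N.
apply: (@count_pairs _ _ Q 0 (fun=> 0)) => //.
- by rewrite muln_gt0.
- move=> p x [E p0 pB xA]; split => //; [split => //| exact: box_supn..].
  have -> : 2 * dot p (nu - p) - kappa = 2 * dot p x by rewrite -E /dot /=; ring.
  have := absz_dot_le p x; have : (supn p * supn x <= 2 * B * A)%N by exact: leq_mul.
  rewrite abszM -mulnA; lia.
- move=> p x y [+ _ _ _] [+ _ _ _] /=; rewrite /dot /=; lia.
apply: (@sum_le_inj _ _ _ (fun m : vec3 => m + m - nu) (fun z => exists2 m, Q m & z = m + m - nu) _ (fun=> 1)).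
- by move=> m Qm; exists m.
- by [].
- move=> [[a b] c] [[a' b'] c'] _ _ [] /= e1 e2 e3; congr (_, _, _); lia.
have B40 : (0 < 4 * B)%N by rewrite muln_gt0.
(* As |2 m - nu|^2 = |nu|^2 - 4 m . (nu - m), two such squares differ by at most 4 * 12 A B, and 2 m
   stays within 4 B of the origin in each coordinate. *)
apply: sum_le_mono (@count_shell R (fun z => exists2 m, Q m & z = m + m - nu) (- nu) (4 * B) (48 * (A * B)) B40 _ _) => //.
- rewrite !natrM.
  have : 54 * (4 * B%:R) ^+ 2 <= 54 * (4 * B%:R) ^+ 2 * A%:R :> R by rewrite ler_peMr ?mulr_ge0 ?exprn_ge0 ?mulr_ge0.
  nra.
- move=> _ [m [mB _] ->]; move: mB; rewrite /box /nearz /supn /=; lia.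
- move=> _ _ [m [_ h] ->] [m' [_ h'] ->].
  have -> : dot (m + m - nu) (m + m - nu) - dot (m' + m' - nu) (m' + m' - nu) =
    2 * (2 * dot m' (nu - m') - kappa) - 2 * (2 * dot m (nu - m) - kappa).
    by rewrite /dot /=; ring.
  lia.
Qed.

End Resonance.

(** * The weighted resonance sum *)

Section ResonanceSum.
Variable R : archiRealFieldType.
Implicit Types (nu n : vec3) (tau kappa : int) (A B M : nat).

(** The square <n>^2 of the Japanese bracket. *)
Definition jap n : R := 1 + (dot n n)%:~R.

Definition scale n : nat := (2 ^ up_log 2 (supn n))%N.

(** A majorant of <n>^-2 that is constant on dyadic shells. *)
Definition dyad n : R := 4 * ((scale n)%:R ^+ 2)^-1.

Lemma scale_gt0 n : 0 < (scale n)%:R :> R.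
Proof. by rewrite ltr0n expn_gt0. Qed.

Lemma supn_scale n : (supn n <= scale n)%N.
Proof. exact: up_logP. Qed.

Lemma dot_self_ge0 n : 0 <= dot n n.
Proof. by rewrite /dot !addr_ge0// -expr2 sqr_ge0. Qed.

Lemma supn_sqr_le n : ((supn n)%:Z ^+ 2 <= dot n n)%R.
Proof.
have [E|] := eqVneq (supn n) (absz n.2); first by rewrite E /dot; nia.
have [E _|] := eqVneq (supn n) (absz n.1.2); first by rewrite E /dot; nia.
move=> E1 E2; have -> : supn n = absz n.1.1 by move: E1 E2; rewrite /supn; lia.
rewrite /dot; nia.
Qed.

Lemma jap_ge1 n : 1 <= jap n.
Proof. by rewrite /jap lerDl ler0z dot_self_ge0. Qed.

Lemma jap_gt0 n : 0 < jap n.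
Proof. exact: lt_le_trans (jap_ge1 n). Qed.

(** The scale is below 2 |n| as soon as |n| exceeds 1 in the sup norm, and it is 1 otherwise; the
    factor 4 pays for this rounding. *)
Lemma jap_inv_le n : (jap n)^-1 <= dyad n.
Proof.
have s0 := scale_gt0 n.
rewrite /dyad -[4 * _]invrK lef_pV2 ?posrE ?jap_gt0 ?invr_gt0 ?mulr_gt0 ?invr_gt0 ?exprn_gt0//.
rewrite invfM invrK mulrC ler_pdivrMr//.
suff : ((scale n)%:Z ^+ 2 <= (1 + dot n n) * 4)%R.
  by rewrite -(ler_int R) rmorphXn/= rmorphM/= rmorphD/=.
have [le1|gt1] := leqP (supn n) 1.
  rewrite /scale (_ : up_log 2 (supn n) = 0%N); last by apply/eqP; rewrite up_log_eq0 le1.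
  by have := dot_self_ge0 n; lia.
have := up_log_gtn (isT : (1 < 2)%N) gt1; have := supn_sqr_le n.
have : (0 < up_log 2 (supn n))%N by rewrite up_log_gt0.
rewrite /scale; case: up_log => // l _ /=; rewrite expnS; set u := (2 ^ l)%N.
move=> h1 h2; have : ((u%:Z) ^+ 2 <= (supn n)%:Z ^+ 2)%R by rewrite lerXn2r ?nnegrE// ltW.
by rewrite PoszM exprMn; lia.
Qed.

Lemma count_leq (L : nat) : sum_le (fun i : nat => (i <= L)%N) (fun=> 1 : R) L.+1%:R.
Proof.
move=> s us sP; rewrite big_const_seq count_predT iter_addr_0 ler_nat.
rewrite -(size_iota 0 L.+1) uniq_leq_size// => i /sP.
by rewrite mem_iota ltnS.
Qed.

(** A shell of scale u has at most 27 u^3 points, each of weight 16 / u^4. Bounding every shell by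
    the same constant costs one logarithm, which the square of the logarithm in the final sum
    absorbs. *)
Lemma sum_dyad_sqr M :
  sum_le (fun n => (supn n <= M)%N) (fun n => dyad n * dyad n)
    (432 * (up_log 2 M).+1%:R).
Proof.
have K0 : 0 < 432 :> R by rewrite ltr0n.
have K0' := ltW K0.
apply: (@sum_le_fiber _ _ _ (fun n => up_log 2 (supn n))
  (fun i => (i <= up_log 2 M)%N) _ (fun=> 432)).
- by move=> n; exact: leq_up_log.
- move=> i _.
  have u0 : (0 < 2 ^ i)%N by rewrite expn_gt0.
  set u := (2 ^ i)%N in u0 *.
  have u1 : 1 <= u%:R :> R by rewrite ler1n.
  pose w : R := 4 * (u%:R ^+ 2)^-1.
  apply: (@sum_le_mono _ _ _ (box 0 u) _ (fun=> w * w) _ (w * w * (27 * u%:R ^+ 3))).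
  + by move=> n [_ E]; apply: box_supn; rewrite /u -E; exact: supn_scale.
  + by move=> n [_ E]; rewrite /w /u -E.
  + have -> : w * w * (27 * u%:R ^+ 3) = 432 * u%:R^-1.
      by rewrite /w; field; apply/eqP; lra.
    rewrite (ger_pMr _ K0) invf_le1 ?u1//.
    exact: lt_le_trans ltr01 u1.
  + apply: sum_le_cst => //; last exact: count_box_cube.
    by rewrite mulr_ge0// mulr_ge0 ?invr_ge0 ?exprn_ge0.
- exact: (sum_le_cst K0' (fun _ _ => lexx _) (@count_leq _)).
Qed.

(** On shells of scales u and v the weight is 16 / (u^2 v^2) and there are at most C u^2 v^2 pairs,
    so each pair of scales contributes at most 16 C. *)
Lemma sum_dyad_pairs (P : vec3 * vec3 -> Prop) M (C : R) : 0 <= C ->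
  (forall z, P z -> (supn z.1 <= M)%N /\ (supn z.2 <= M)%N) ->
  (forall A B, (0 < A)%N -> (0 < B)%N ->
    sum_le (fun z => [/\ P z, (supn z.1 <= A)%N & (supn z.2 <= B)%N]) (fun=> 1)
      (C * A%:R ^+ 2 * B%:R ^+ 2)) ->
  sum_le P (fun z => dyad z.1 * dyad z.2) (16 * C * (up_log 2 M).+1%:R ^+ 2).
Proof.
move=> C0 PM Pc; pose lev n := up_log 2 (supn n).
apply: (@sum_le_fiber _ _ _ (fun z => (lev z.1, lev z.2))
  (fun i => (i.1 <= up_log 2 M)%N /\ (i.2 <= up_log 2 M)%N) _ (fun=> 16 * C)).
- by move=> z /PM[? ?]; split; exact: leq_up_log.
- move=> [i l] _.
  have u0 : (0 < 2 ^ i)%N by rewrite expn_gt0.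
  have v0 : (0 < 2 ^ l)%N by rewrite expn_gt0.
  have := Pc _ _ u0 v0; set u := (2 ^ i)%N; set v := (2 ^ l)%N => H.
  have nz k : (0 < k)%N -> k%:R != 0 :> R by move=> k0; rewrite pnatr_eq0 -lt0n.
  pose w : R := (4 * (u%:R ^+ 2)^-1) * (4 * (v%:R ^+ 2)^-1).
  have -> : 16 * C = w * (C * u%:R ^+ 2 * v%:R ^+ 2).
    by rewrite /w; field; rewrite !nz.
  apply: sum_le_cst.
  + by rewrite /w !mulr_ge0 ?invr_ge0 ?exprn_ge0.
  + by move=> z [_ [E1 E2]]; rewrite /w /u /v -E1 -E2.
  + apply: sum_le_mono H => // z [Pz [E1 E2]]; split => //.
      by rewrite /u -E1; exact: supn_scale.
    by rewrite /v -E2; exact: supn_scale.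
- apply: sum_le_cst; rewrite ?mulr_ge0// expr2.
  exact: (sum_le_prod (ler0n R _) (@count_leq (up_log 2 M)) (@count_leq (up_log 2 M))).
Qed.

Lemma japM_le nu n1 n2 n3 : n1 + n2 - n3 = nu ->
  jap nu <= 3 * (jap n1 + jap n2 + jap n3).
Proof.
move=> <-; rewrite /jap.
suff : (dot (n1 + n2 - n3) (n1 + n2 - n3) <= 3 * (dot n1 n1 + dot n2 n2 + dot n3 n3))%R.
  by rewrite -(ler_int R) rmorphM/= !rmorphD/= => H; lra.
have H (a b c : int) : (a + b - c) * (a + b - c) <= 3 * (a * a + b * b + c * c).
  by have := sqr_ge0 (a - b); have := sqr_ge0 (a + c); have := sqr_ge0 (b + c); nia.
have := H n1.1.1 n2.1.1 n3.1.1; have := H n1.1.2 n2.1.2 n3.1.2.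
have := H n1.2 n2.2 n3.2; rewrite /dot /=; lia.
Qed.

Definition resonant nu tau M (z : vec3 * vec3 * vec3) : Prop :=
  [/\ z.1.1 + z.1.2 - z.2 = nu,
      dot z.1.1 z.1.1 + dot z.1.2 z.1.2 - dot z.2 z.2 = tau,
      (supn z.1.1 <= M)%N, (supn z.1.2 <= M)%N & (supn z.2 <= M)%N].

(** Eliminating n3 cancels |n1|^2 and |n2|^2 in the quadratic constraint and leaves an equation
    bilinear in n1 - nu and n2 - nu. *)
Lemma resonantE nu tau M n1 n2 n3 : resonant nu tau M (n1, n2, n3) ->
  n3 = n1 + n2 - nu /\ 2 * dot (n1 - nu) (n2 - nu) = dot nu nu - tau.
Proof.
case=> /= <- <- _ _ _; split.
  by rewrite subKr.
by rewrite /dot /=; ring.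
Qed.

Lemma sum_resonant : exists2 C : R, 0 < C & forall nu tau M,
  sum_le (resonant nu tau M)
    (fun z => jap nu / (jap z.1.1 * jap z.1.2 * jap z.2))
    (C * (up_log 2 M).+1%:R ^+ 2).
Proof.
have [C4 C4_0 H4] : exists2 C : R, 0 < C & forall M,
    sum_le (fun n => (supn n <= M)%N) (fun n => dyad n * dyad n)
      (C * (up_log 2 M).+1%:R).
  by exists 432; [rewrite ltr0n | exact: sum_dyad_sqr].
have [C12 C12_0 H12] : exists2 C : R, 0 <= C & forall nu kappa A B,
    (0 < A)%N -> (0 < B)%N ->
    sum_le (fun z : vec3 * vec3 => [/\ 2 * dot (z.1 - nu) (z.2 - nu) = kappa,
        z.1 != nu, z.2 != nu, (supn z.1 <= A)%N & (supn z.2 <= B)%N])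
      (fun=> 1) (C * A%:R ^+ 2 * B%:R ^+ 2).
  by exists 1215; [exact: ler0n | exact: count_resonant12].
have [C23 C23_0 H23] : exists2 C : R, 0 <= C & forall nu kappa A B,
    (0 < A)%N -> (0 < B)%N ->
    sum_le (fun z : vec3 * vec3 => [/\ 2 * dot (z.2 - z.1) (z.1 - nu) = kappa,
        z.1 != nu, z.1 != z.2, (supn z.1 <= B)%N & (supn z.2 <= A)%N])
      (fun=> 1) (C * A%:R ^+ 2 * B%:R ^+ 2).
  exists (320 * 1000); last exact: count_resonant23.
  exact: mulr_ge0 (ler0n _ _) (ler0n _ _).
exists (C4 + (C4 + (3 * (16 * C12 + 16 * C23 + 16 * C23)))).
  by lra.
move=> nu tau M; set L := (up_log 2 M).+1%:R : R.
have L1 : 1 <= L by rewrite ler1n.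
have jn0 n : jap n != 0 by rewrite gt_eqF// jap_gt0.
have LL : C4 * L <= C4 * L ^+ 2 by rewrite expr2 ler_wpM2l ?ler_peMl//; lra.
(* If n1 = nu, then n3 = n2 and <nu>^2 cancels, which leaves the sum of <n2>^-4. The case n2 = nu is
   treated next in the same way. *)
rewrite mulrDl; apply: (@sum_le_split _ _ (fun z => z.1.1 == nu)).
  apply: (@sum_le_inj _ _ _ (fun z => z.1.2) (fun n => (supn n <= M)%N) _
    (fun n => dyad n * dyad n)).
  - by move=> z [[]].
  - move=> [[n1 n2] n3] [/resonantE[-> _] /eqP /= ->].
    rewrite addrAC subrr add0r -mulrA invfM mulrA divff// mul1r invfM.
    by rewrite ler_pM ?invr_ge0 ?(ltW (jap_gt0 _)) ?jap_inv_le.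
  - move=> [[n1 n2] n3] [[m1 m2] m3] [/resonantE[-> _] /eqP /= ->].
    by case=> [/resonantE[-> _] /eqP /= ->] ->.
  - exact: sum_le_mono (H4 M).
rewrite mulrDl; apply: (@sum_le_split _ _ (fun z => z.1.2 == nu)).
  apply: (@sum_le_inj _ _ _ (fun z => z.1.1) (fun n => (supn n <= M)%N) _
    (fun n => dyad n * dyad n)).
  - by move=> z [[[]]].
  - move=> [[n1 n2] n3] [[/resonantE[-> _] _] /eqP /= ->].
    rewrite addrK mulrAC invfM mulrCA divff// mulr1 invfM.
    by rewrite ler_pM ?invr_ge0 ?(ltW (jap_gt0 _)) ?jap_inv_le.
  - move=> [[n1 n2] n3] [[m1 m2] m3] [[/resonantE[-> _] _] /eqP /= ->].
    by case=> [[/resonantE[-> _] _] /eqP /= ->] ->.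
  - exact: sum_le_mono (H4 M).
set P := fun z => _.
apply: (@sum_le_mono _ _ _ P _ (fun z => 3 * (dyad z.1.1 * dyad z.1.2 +
    dyad z.1.2 * dyad z.2 + dyad z.1.1 * dyad z.2)) _
  (3 * (16 * C12 * L ^+ 2 + 16 * C23 * L ^+ 2 + 16 * C23 * L ^+ 2))) => //.
- move=> [[n1 n2] n3] [[[/= /japM_le h _ _ _ _] _] _].
  (* By [japM_le], each of the three terms that bound the numerator cancels one factor of the
     denominator. *)
  apply: le_trans (_ : 3 * ((jap n1)^-1 * (jap n2)^-1 + (jap n2)^-1 * (jap n3)^-1 +
    (jap n1)^-1 * (jap n3)^-1) <= _); last first.
    by rewrite ler_wpM2l// !lerD// ler_pM ?invr_ge0 ?(ltW (jap_gt0 _)) ?jap_inv_le.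
  have -> : 3 * ((jap n1)^-1 * (jap n2)^-1 + (jap n2)^-1 * (jap n3)^-1 +
    (jap n1)^-1 * (jap n3)^-1) =
    3 * (jap n1 + jap n2 + jap n3) / (jap n1 * jap n2 * jap n3).
    by field; rewrite !jn0.
  by rewrite ler_wpM2r// invr_ge0 !mulr_ge0// ltW// jap_gt0.
- by rewrite -[leRHS]mulrA ler_wpM2l // -!mulrDl.
apply: sum_leZ => //; apply: sum_leD; first apply: sum_leD.
- apply: (@sum_le_inj _ _ _ (fun z => z.1)
    (fun z => [/\ 2 * dot (z.1 - nu) (z.2 - nu) = dot nu nu - tau, z.1 != nu, z.2 != nu,
      (supn z.1 <= M)%N & (supn z.2 <= M)%N]) _ (fun z => dyad z.1 * dyad z.2)).
  + by move=> [[n1 n2] n3] [[/[dup] /resonantE[_ E] [_ _ ? ? _] ?] ?].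
  + by [].
  + move=> [[n1 n2] n3] [[m1 m2] m3] [[/resonantE[-> _] _] _].
    by case=> [[/resonantE[-> _] _] _] /= [-> ->].
  + apply: sum_dyad_pairs => //; first by move=> z [].
    move=> A B A0 B0; apply: sum_le_mono (H12 nu (dot nu nu - tau) A B A0 B0) => //.
    by move=> z [[]].
(* Since n1 - nu = n3 - n2, the pair (n2, n3) satisfies the relation of [count_resonant23]; there n2
   <> n3 amounts to n1 <> nu, and the pair determines n1. *)
- apply: (@sum_le_inj _ _ _ (fun z => (z.1.2, z.2))
    (fun z => [/\ 2 * dot (z.2 - z.1) (z.1 - nu) = dot nu nu - tau, z.1 != nu, z.1 != z.2,
      (supn z.1 <= M)%N & (supn z.2 <= M)%N]) _ (fun z => dyad z.1 * dyad z.2)).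
  + move=> [[n1 n2] n3] [[/[dup] /resonantE[e E] [_ _ ? ? ?] /= n1nu] ?].
    split => //=; first by rewrite -E e addrAC addrK.
    by apply: contraNneq n1nu => E'; move: e; rewrite -E' addrAC -[LHS]add0r => /addIr/esym/eqP; rewrite subr_eq0.
  + by [].
  + move=> [[n1 n2] n3] [[m1 m2] m3] [[/resonantE[e _] _] _].
    case=> [[/resonantE[e' _] _] _] /= [h2 h3]; congr (_, _, _) => //.
    by move: e; rewrite h2 h3 e' => /addIr/addIr.
  + apply: sum_dyad_pairs => //; first by move=> z [].
    move=> A B A0 B0; apply: sum_le_mono (H23 nu (dot nu nu - tau) B A B0 A0) => //.
      by move=> z [[]].
    by rewrite mulrAC.
(* The same with n1 and n2 interchanged. *)
- apply: (@sum_le_inj _ _ _ (fun z => (z.1.1, z.2))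
    (fun z => [/\ 2 * dot (z.2 - z.1) (z.1 - nu) = dot nu nu - tau, z.1 != nu, z.1 != z.2,
      (supn z.1 <= M)%N & (supn z.2 <= M)%N]) _ (fun z => dyad z.1 * dyad z.2)).
  + move=> [[n1 n2] n3] [[/[dup] /resonantE[e E] [_ _ ? ? ?] /= n1nu] n2nu].
    split => //=; first by rewrite -E e addrAC [n1 + n2]addrC addrK /dot; ring.
    by apply: contraNneq n2nu => E'; move: e; rewrite -E' -addrA -[LHS]addr0 => /addrI/esym/eqP; rewrite subr_eq0.
  + by [].
  + move=> [[n1 n2] n3] [[m1 m2] m3] [[/resonantE[e _] _] _].
    case=> [[/resonantE[e' _] _] _] /= [h2 h3]; congr (_, _, _) => //.
    by move: e; rewrite h2 h3 e' => /addIr/addrI.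
  + apply: sum_dyad_pairs => //; first by move=> z [].
    move=> A B A0 B0; apply: sum_le_mono (H23 nu (dot nu nu - tau) B A B0 A0) => //.
      by move=> z [[]].
    by rewrite mulrAC.
Qed.

End ResonanceSum.

Local Open Scope classical_set_scope.
Local Open Scope ring_scope.

(** * Integrals of bounded complex functions *)

Section BoundedMeasurable.
Context d (T : measurableType d) (R : realType).

(** Unlike integrable functions, bounded measurable ones are closed under products, and they are
    integrable for every finite measure; this settles the side conditions of the integral identities
    below. *)
Definition bmeas (f : T -> R) : Prop :=
  measurable_fun setT f /\ exists M, forall x, `|f x| <= M.

Lemma bmeas_cst (c : R) : bmeas (fun=> c).
Proof. by split; [exact: measurable_cst | exists `|c|]. Qed.

Lemma bmeasD (f g : T -> R) : bmeas f -> bmeas g -> bmeas (fun x => f x + g x).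
Proof.
move=> [mf [M fM]] [mg [N gN]]; split; first exact: measurable_funD.
by exists (M + N) => x; rewrite (le_trans (ler_normD _ _))// lerD.
Qed.

Lemma bmeasM (f g : T -> R) : bmeas f -> bmeas g -> bmeas (fun x => f x * g x).
Proof.
move=> [mf [M fM]] [mg [N gN]]; split; first exact: measurable_funM.
by exists (M * N) => x; rewrite normrM ler_pM.
Qed.

Lemma bmeasN (f : T -> R) : bmeas f -> bmeas (fun x => - f x).
Proof.
move=> [mf [M fM]]; split; last by exists M => x; rewrite normrN.
by apply: measurableT_comp.
Qed.

Lemma bmeas_cos (f : T -> R) : measurable_fun setT f -> bmeas (fun x => cos (f x)).
Proof.
move=> mf; split.
  apply: (measurableT_comp _ mf); apply: continuous_measurable_fun.
  exact: continuous_cos.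
by exists 1 => x; rewrite ler_norml cos_geN1 cos_le1.
Qed.

Lemma bmeas_sin (f : T -> R) : measurable_fun setT f -> bmeas (fun x => sin (f x)).
Proof.
move=> mf; split.
  apply: (measurableT_comp _ mf); apply: continuous_measurable_fun.
  exact: continuous_sin.
by exists 1 => x; rewrite ler_norml sin_geN1 sin_le1.
Qed.

Lemma bmeas_integrable (mu : {finite_measure set T -> \bar R}) (f : T -> R) :
  bmeas f -> mu.-integrable setT (EFin \o f).
Proof.
move=> [mf [M fM]]; apply: measurable_bounded_integrable => //.
  by rewrite ltey_eq fin_num_measure.
exists M; split; first exact: num_real.
by move=> y My x _; apply: le_trans (fM x) (ltW My).
Qed.

End BoundedMeasurable.

Section ComplexIntegral.
Context d (T : measurableType d) (R : realType).
Implicit Types (f g : T -> R[i]).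

Definition cbmeas f : Prop :=
  bmeas (fun x => complex.Re (f x)) /\ bmeas (fun x => complex.Im (f x)).

Lemma cbmeas_cexpi (h : T -> R) : measurable_fun setT h ->
  cbmeas (fun x => cexpi (h x)).
Proof. by split; [exact: bmeas_cos | exact: bmeas_sin]. Qed.

Lemma ReD (x y : R[i]) : complex.Re (x + y) = complex.Re x + complex.Re y.
Proof. by case: x y => [? ?] [? ?]. Qed.

Lemma ImD (x y : R[i]) : complex.Im (x + y) = complex.Im x + complex.Im y.
Proof. by case: x y => [? ?] [? ?]. Qed.

Lemma ReM (x y : R[i]) : complex.Re (x * y) =
  complex.Re x * complex.Re y + - (complex.Im x * complex.Im y).
Proof. by case: x y => [? ?] [? ?]. Qed.

Lemma ImM (x y : R[i]) : complex.Im (x * y) =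
  complex.Re x * complex.Im y + complex.Im x * complex.Re y.
Proof. by case: x y => [? ?] [? ?]. Qed.

Lemma complex_ext (x y : R[i]) :
  complex.Re x = complex.Re y -> complex.Im x = complex.Im y -> x = y.
Proof. by case: x y => [? ?] [? ?] /= -> ->. Qed.

Lemma cbmeas_cst (c : R[i]) : cbmeas (fun=> c).
Proof. by split; exact: bmeas_cst. Qed.

Lemma cbmeasD f g : cbmeas f -> cbmeas g -> cbmeas (fun x => f x + g x).
Proof.
move=> [f1 f2] [g1 g2]; split.
  by under [X in bmeas X]eq_fun do rewrite ReD; exact: bmeasD.
by under [X in bmeas X]eq_fun do rewrite ImD; exact: bmeasD.
Qed.

Lemma cbmeasM f g : cbmeas f -> cbmeas g -> cbmeas (fun x => f x * g x).
Proof.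
move=> [f1 f2] [g1 g2]; split.
  under [X in bmeas X]eq_fun do rewrite ReM.
  by apply: bmeasD; [|apply: bmeasN]; exact: bmeasM.
under [X in bmeas X]eq_fun do rewrite ImM.
by apply: bmeasD; exact: bmeasM.
Qed.

Lemma cbmeas_sum (I : Type) (s : seq I) (f : I -> T -> R[i]) :
  (forall i, cbmeas (f i)) -> cbmeas (fun x => \sum_(i <- s) f i x).
Proof.
move=> H; elim: s => [|i s IH].
  by under [X in cbmeas X]eq_fun do rewrite big_nil; exact: cbmeas_cst.
by under [X in cbmeas X]eq_fun do rewrite big_cons; exact: cbmeasD.
Qed.

Lemma cbmeas_prod (I : Type) (s : seq I) (f : I -> T -> R[i]) :
  (forall i, cbmeas (f i)) -> cbmeas (fun x => \prod_(i <- s) f i x).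
Proof.
move=> H; elim: s => [|i s IH].
  by under [X in cbmeas X]eq_fun do rewrite big_nil; exact: cbmeas_cst.
by under [X in cbmeas X]eq_fun do rewrite big_cons; exact: cbmeasM.
Qed.

Section FiniteMeasure.
Variable mu : {finite_measure set T -> \bar R}.

Lemma cintD f g : cbmeas f -> cbmeas g ->
  cint mu (fun x => f x + g x) = cint mu f + cint mu g.
Proof.
move=> [f1 f2] [g1 g2]; rewrite /cint.
under eq_Rintegral do rewrite ReD; under [X in (_ +i* X)%C]eq_Rintegral do rewrite ImD.
by rewrite !RintegralD//; exact: bmeas_integrable.
Qed.

Lemma cintZ (c : R[i]) f : cbmeas f ->
  cint mu (fun x => c * f x) = c * cint mu f.
Proof.
move=> [f1 f2]; rewrite /cint.
have i1 := bmeas_integrable mu f1; have i2 := bmeas_integrable mu f2.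
under eq_Rintegral do rewrite ReM; under [X in (_ +i* X)%C]eq_Rintegral do rewrite ImM.
have P r h : bmeas h -> bmeas (fun x : T => r * h x) by apply: bmeasM; exact: bmeas_cst.
rewrite RintegralB ?RintegralD ?RintegralZl//; try by apply: bmeas_integrable; exact: P.
by case: c.
Qed.

Lemma cint_sum (I : Type) (s : seq I) (c : I -> R[i]) (f : I -> T -> R[i]) :
  (forall i, cbmeas (f i)) ->
  cint mu (fun x => \sum_(i <- s) c i * f i x) = \sum_(i <- s) c i * cint mu (f i).
Proof.
move=> H; elim: s => [|i s IH].
  rewrite big_nil /cint; under eq_Rintegral do rewrite big_nil.
  under [X in (_ +i* X)%C]eq_Rintegral do rewrite big_nil.
  by rewrite !Rintegral_cst//= mul0r.
rewrite big_cons -IH -cintZ// -cintD.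
- by congr cint; apply/funext => x; rewrite big_cons.
- exact: (cbmeasM (cbmeas_cst _)).
- by apply: cbmeas_sum => j; exact: (cbmeasM (cbmeas_cst _)).
Qed.

End FiniteMeasure.
End ComplexIntegral.

Lemma cbmeas_comp d1 d2 (T1 : measurableType d1) (T2 : measurableType d2)
    (R : realType) (h : T1 -> T2) (f : T2 -> R[i]) :
  measurable_fun setT h -> cbmeas f -> cbmeas (f \o h).
Proof.
move=> mh [[m1 [M1 b1]] [m2 [M2 b2]]]; split; split.
- exact: (measurableT_comp m1 mh).
- by exists M1 => x; exact: b1.
- exact: (measurableT_comp m2 mh).
- by exists M2 => x; exact: b2.
Qed.

Section ProductIntegral.
Context d1 d2 (T1 : measurableType d1) (T2 : measurableType d2) (R : realType).
Variables (mu : {finite_measure set T1 -> \bar R})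
  (nu : {finite_measure set T2 -> \bar R}).

Lemma Rintegral_mprodM (f : T1 -> R) (g : T2 -> R) : bmeas f -> bmeas g ->
  Rintegral (mprod mu nu) setT (fun z => f z.1 * g z.2) =
  Rintegral mu setT f * Rintegral nu setT g.
Proof.
move=> bf bg.
have bfg : bmeas (fun z : T1 * T2 => f z.1 * g z.2).
  apply: bmeasM.
    by case: bf => mf [M fM]; split; [exact: (measurableT_comp mf) | exists M].
  by case: bg => mg [M gM]; split; [exact: (measurableT_comp mg) | exists M].
have i1 := bmeas_integrable mu bf; have i2 := bmeas_integrable nu bg.
have i12 := bmeas_integrable (mprod mu nu) bfg.
rewrite {1}/Rintegral -(integral12_prod_meas1 i12) /fubini_F /=.
under eq_integral => x _.
  under eq_integral do rewrite EFinM.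
  rewrite integralZl// -[X in (_ * X)%E]fineK; last exact: integrable_fin_num.
  over.
rewrite /= integralZr//.
by rewrite fineM//; exact: integrable_fin_num.
Qed.

Lemma cint_mprodM (f : T1 -> R[i]) (g : T2 -> R[i]) : cbmeas f -> cbmeas g ->
  cint (mprod mu nu) (fun z => f z.1 * g z.2) = cint mu f * cint nu g.
Proof.
move=> [f1 f2] [g1 g2]; rewrite /cint.
have P (a : T1 -> R) (b : T2 -> R) : bmeas a -> bmeas b ->
    bmeas (fun z : T1 * T2 => a z.1 * b z.2).
  move=> [ma [M aM]] [mb [N bN]]; apply: bmeasM.
    by split; [exact: (measurableT_comp ma) | exists M].
  by split; [exact: (measurableT_comp mb) | exists N].
under eq_Rintegral do rewrite ReM; under [X in (_ +i* X)%C]eq_Rintegral do rewrite ImM.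
have i11 := bmeas_integrable (mprod mu nu) (P _ _ f1 g1).
have i12 := bmeas_integrable (mprod mu nu) (P _ _ f1 g2).
have i21 := bmeas_integrable (mprod mu nu) (P _ _ f2 g1).
have i22 := bmeas_integrable (mprod mu nu) (P _ _ f2 g2).
rewrite RintegralB ?RintegralD//.
have := Rintegral_mprodM f1 g1; have := Rintegral_mprodM f1 g2.
have := Rintegral_mprodM f2 g1; have := Rintegral_mprodM f2 g2.
by move=> /= -> -> -> ->; case: (cint mu f) => ? ?.
Qed.

End ProductIntegral.

Section PowerMeasure.
Context d (T : measurableType d) (R : realType).
Variable mu : {finite_measure set T -> \bar R}.

Lemma Rintegral_mcons n (nu : {finite_measure set (n.-tuple T) -> \bar R})
    (h : n.+1.-tuple T -> R) : bmeas h ->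
  Rintegral (mcons mu nu) setT h =
  Rintegral (mprod mu nu) setT (h \o @cons_tuple_pair _ T n).
Proof.
move=> [mh [M hM]]; rewrite /Rintegral; congr fine.
have mc := @measurable_cons_tuple_pair _ T n.
have bc : bmeas (h \o @cons_tuple_pair _ T n).
  by split; [exact: (measurableT_comp mh) | exists M => x /=].
have mh' : measurable_fun setT (EFin \o h) by exact/measurable_EFinP.
have ic : (mprod mu nu).-integrable (@cons_tuple_pair _ T n @^-1` setT)
    ((EFin \o h) \o @cons_tuple_pair _ T n).
  by rewrite preimage_setT; exact: (bmeas_integrable (mprod mu nu) bc).
by have := integral_pushforward mc mh' ic measurableT; rewrite preimage_setT.
Qed.

Lemma cint_mcons n (nu : {finite_measure set (n.-tuple T) -> \bar R})
    (h : n.+1.-tuple T -> R[i]) : cbmeas h ->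
  cint (mcons mu nu) h = cint (mprod mu nu) (h \o @cons_tuple_pair _ T n).
Proof.
move=> [h1 h2]; rewrite /cint.
by have -> := Rintegral_mcons nu h1; have -> := Rintegral_mcons nu h2.
Qed.

(** Fubini in the first variable and induction; for n = 0 the measure is a unit mass at the empty
    tuple, which matches the empty product. *)
Lemma cint_mpow_prod n (f : 'I_n -> T -> R[i]) : (forall j, cbmeas (f j)) ->
  cint (mpow mu n) (fun x => \prod_(j < n) f j (tnth x j)) =
  \prod_(j < n) cint mu (f j).
Proof.
have bt m (g : 'I_m -> T -> R[i]) : (forall j, cbmeas (g j)) ->
    cbmeas (fun x : m.-tuple T => \prod_(j < m) g j (tnth x j)).
  move=> H; apply: cbmeas_prod => j.
  by apply: (cbmeas_comp (measurable_tnth j)); exact: H.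
elim: n f => [|n IH] f bf.
  rewrite big_ord0 /cint.
  under eq_Rintegral do rewrite big_ord0.
  under [X in (_ +i* X)%C]eq_Rintegral do rewrite big_ord0.
  rewrite !Rintegral_cst// [X in fine X](_ : _ = 1%E); last by rewrite /= diracE in_setT.
  by rewrite mul1r mul0r.
have b1 := bt _ (fun j => f (lift ord0 j)) (fun j => bf _).
rewrite big_ord_recl -(IH (fun j => f (lift ord0 j)))// -(cint_mprodM _ _ (bf ord0) b1).
rewrite [LHS](cint_mcons (mpow mu n) (bt _ f bf)).
congr cint; apply/funext => z; rewrite /= big_ord_recl /=.
by congr (_ * _); apply: eq_bigr => j _; rewrite tnthS.
Qed.

End PowerMeasure.

(** * Integration over one period *)

Section Period.
Variable R : realType.
Local Notation D := (`[0%R, (2 * pi)%R]%classic : set (measurableTypeR R)).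

Lemma integral_period (f : measurableTypeR R -> R) : bmeas f ->
  (\int[period_measure R]_x (f x)%:E = \int[lebesgue_measure]_(x in D) (f x)%:E)%E.
Proof.
move=> bf; have mD : measurable D by exact: measurable_itv.
have N0 : period_measure R (~` D) = 0%E.
  by rewrite /period_measure /= /mfrestr /mrestr setICl measure0.
rewrite (negligible_integral (measurableC mD) measurableT (bmeas_integrable (period_measure R) bf) N0).
rewrite setDE setCK setTI; apply: eq_measure_integral => A mA AD.
by rewrite /period_measure /= /mfrestr /mrestr setIidl.
Qed.

Lemma sin_2pi_int (m : int) : sin (2 * pi * m%:~R) = 0 :> R.
Proof.
have H (n : nat) : sin (2 * pi * n%:R) = 0 :> R.
  have := periodicn (@sinD2pi R) n 0; rewrite add0r sin0 => <-.
  by congr sin; rewrite -[RHS]mulr_natr -[pi *+ 2]mulr_natr [2 * pi]mulrC.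
by case: m => n; rewrite ?NegzE ?mulrNz ?mulrN ?sinN -?pmulrn H ?oppr0.
Qed.

Lemma cos_2pi_int (m : int) : cos (2 * pi * m%:~R) = 1 :> R.
Proof.
have H (n : nat) : cos (2 * pi * n%:R) = 1 :> R.
  have := periodicn (@cosD2pi R) n 0; rewrite add0r cos0 => E; rewrite -[RHS]E.
  by congr cos; rewrite -[RHS]mulr_natr -[pi *+ 2]mulr_natr [2 * pi]mulrC.
by case: m => n; rewrite ?NegzE ?mulrNz ?mulrN ?cosN -?pmulrn H.
Qed.

Lemma Rintegral_period_deriv (f F : R -> R) :
  continuous f -> bmeas (f : measurableTypeR R -> R) ->
  (forall x : R, is_derive x (1 : R) F (f x)) ->
  Rintegral (period_measure R) setT f = F (2 * pi) - F 0.
Proof.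
move=> cf bf dF.
have cF : continuous F.
  move=> x; apply: differentiable_continuous; apply/derivable1_diffP.
  by have [] := dF x.
rewrite /Rintegral integral_period//.
rewrite (@continuous_FTC2 _ f F)//.
- by rewrite mulr_gt0 ?pi_gt0.
- exact: continuous_subspaceT.
- split.
  + by move=> x _; have [] := dF x.
  + by apply: cvg_at_right_filter; exact: cF.
  + by apply: cvg_at_left_filter; exact: cF.
- by move=> x _; rewrite derive1E; have [_ ->] := dF x.
Qed.

(** For nonzero m the antiderivatives sin(m t) / m and - cos(m t) / m have period 2 pi, so only m =
    0 contributes. *)
Lemma cint_period (m : int) :
  cint (period_measure R) (fun t : R => cexpi (t * m%:~R)) =
  (2 * pi * (m == 0)%:R)%:C%C.
Proof.
have [->|m0] := eqVneq m 0.
  rewrite /cint; under eq_Rintegral do rewrite mulr0 /= cos0.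
  under [X in (_ +i* X)%C]eq_Rintegral do rewrite mulr0 /= sin0.
  rewrite (@Rintegral_period_deriv (fun=> 1) id); last 2 first.
  - by move=> x; exact: cvg_cst.
  - exact: bmeas_cst.
  rewrite (@Rintegral_period_deriv (fun=> 0) (fun=> 0)); last 2 first.
  - by move=> x; exact: cvg_cst.
  - exact: bmeas_cst.
  by rewrite !subr0 mulr1.
set c : R := m%:~R; have c0 : c != 0 by rewrite intr_eq0.
have cl : continuous (fun t : R => t * c) by move=> t; apply: cvgMl; exact: cvg_id.
have dS (t : R) : is_derive (t : R) (1 : R) (fun t : R => c^-1 * sin (t * c)) (cos (t * c)).
  by apply: is_derive_eq; rewrite /GRing.scale/=; field.
have dC (t : R) : is_derive (t : R) (1 : R) (fun t : R => - c^-1 * cos (t * c)) (sin (t * c)).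
  by apply: is_derive_eq; rewrite /GRing.scale/=; field.
have mf (t : R -> R) : continuous t -> measurable_fun setT (t : measurableTypeR R -> R).
  exact: continuous_measurable_fun.
have cC : continuous (fun t : R => cos (t * c)).
  by move=> t; apply: (continuous_comp (cl t)); exact: continuous_cos.
have cS : continuous (fun t : R => sin (t * c)).
  by move=> t; apply: (continuous_comp (cl t)); exact: continuous_sin.
rewrite /cint (Rintegral_period_deriv cC (bmeas_cos (mf _ cl)) dS).
rewrite (Rintegral_period_deriv cS (bmeas_sin (mf _ cl)) dC).
by rewrite mul0r sin_2pi_int sin0 cos_2pi_int cos0 !subrr mulr0.
Qed.

End Period.

(** * Parseval for trigonometric polynomials *)

Section Cexpi.
Variable R : realType.
Implicit Types (a b : R) (z w : R[i]).

Lemma cexpiD a b : cexpi (a + b) = cexpi a * cexpi b.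
Proof.
by apply: complex_ext; rewrite ?ReM ?ImM /= ?cosD ?sinD// [RHS]addrC.
Qed.

Lemma cexpi0 : cexpi 0 = 1 :> R[i].
Proof. by rewrite /cexpi cos0 sin0. Qed.

Lemma cexpiN a : cexpi (- a) = ((cexpi a)^*)%C.
Proof. by rewrite /cexpi cosN sinN. Qed.

Lemma cexpi_sum (I : Type) (s : seq I) (f : I -> R) :
  cexpi (\sum_(i <- s) f i) = \prod_(i <- s) cexpi (f i).
Proof. exact: (big_morph _ cexpiD cexpi0). Qed.

Lemma cabs_ge0 z : 0 <= cabs z.
Proof. by rewrite /cabs normc_def /= sqrtr_ge0. Qed.

Lemma cabs_sqr z : cabs z ^+ 2 = complex.Re (z * (z^*)%C).
Proof.
rewrite /cabs normc_def /= sqr_sqrtr ?addr_ge0 ?sqr_ge0//.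
by case: z => x y /=; rewrite mulrN opprK -!expr2.
Qed.

Lemma cabsM z w : cabs (z * w) = cabs z * cabs w.
Proof.
apply/eqP; rewrite -(@eqrXn2 _ 2)// ?mulr_ge0 ?cabs_ge0// exprMn !cabs_sqr.
by apply/eqP; case: z w => [a b] [c e] /=; ring.
Qed.

Lemma cabs_real a : 0 <= a -> cabs (a%:C)%C = a.
Proof. by move=> a0; rewrite /cabs normc_def /= expr0n addr0 sqrtr_sqr ger0_norm. Qed.

Lemma cabsN z : cabs (- z) = cabs z.
Proof. by rewrite /cabs normrN. Qed.

Lemma Re_mulJ_le z w : complex.Re (z * (w^*)%C) <= cabs z * cabs w.
Proof.
apply: (@le_trans _ _ `|complex.Re (z * (w^*)%C)|); first exact: ler_norm.
rewrite -(@ler_pXn2r _ 2)// ?nnegrE ?mulr_ge0 ?cabs_ge0//.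
rewrite exprMn !cabs_sqr real_normK ?num_real//.
case: z w => [a b] [c e] /=.
by have := sqr_ge0 (a * e - b * c); nra.
Qed.

Lemma ReZ a z : complex.Re ((a%:C)%C * z) = a * complex.Re z.
Proof. by case: z => x y /=; rewrite mul0r subr0. Qed.

Lemma Re_sum (I : Type) (s : seq I) (f : I -> R[i]) :
  complex.Re (\sum_(i <- s) f i) = \sum_(i <- s) complex.Re (f i).
Proof. by apply: (big_morph _ (@ReD R)). Qed.

End Cexpi.

(** Parseval in a form that allows repeated frequencies: [e i j] says that i and j carry the same
    one, and the off-diagonal terms are kept. This is needed after a collision, where many inputs
    have the same output frequency. *)
Lemma L2norm_trig d (T : measurableType d) (R : realType)
    (mu : {finite_measure set T -> \bar R}) (I : finType) (c : I -> R[i])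
    (theta : I -> T -> R) (V : R) (e : rel I) :
  (forall i, measurable_fun setT (theta i)) ->
  (forall i j, cint mu (fun z => cexpi (theta i z - theta j z)) =
    ((V * (e i j)%:R)%:C)%C) ->
  L2norm mu (fun z => \sum_i c i * cexpi (theta i z)) =
  (Num.sqrt (V * \sum_i \sum_(j | e i j) complex.Re (c i * ((c j)^*)%C)))%:E.
Proof.
move=> mt orth; set F := fun z => \sum_i _.
pose g (p : I * I) z := cexpi (theta p.1 z - theta p.2 z).
have bg p : cbmeas (g p).
  by apply: cbmeas_cexpi; apply: measurable_funB.
have FF z : F z * ((F z)^*)%C = \sum_(p : I * I) (c p.1 * ((c p.2)^*)%C) * g p z.
  rewrite /F rmorph_sum mulr_suml.
  under eq_bigr do rewrite mulr_sumr.
  rewrite pair_bigA; apply: eq_bigr => -[i j] _ /=.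
  by rewrite /g cexpiD cexpiN rmorphM/=; ring.
have bFF : bmeas (fun z => cabs (F z) ^+ 2).
  have [+ _] : cbmeas (fun z => \sum_(p : I * I) (c p.1 * ((c p.2)^*)%C) * g p z).
    by apply: cbmeas_sum => p; apply: cbmeasM => //; exact: cbmeas_cst.
  by congr bmeas; apply/funext => z; rewrite cabs_sqr FF.
have E : Rintegral mu setT (fun z => cabs (F z) ^+ 2) =
    V * \sum_i \sum_(j | e i j) complex.Re (c i * ((c j)^*)%C).
  transitivity (complex.Re (cint mu (fun z => F z * ((F z)^*)%C))).
    by rewrite /cint /=; apply: eq_Rintegral => z _; rewrite cabs_sqr.
  have -> : (fun z => F z * ((F z)^*)%C) =
      (fun z => \sum_(p : I * I) (c p.1 * ((c p.2)^*)%C) * g p z) by apply/funext.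
  rewrite (cint_sum mu _ _ bg) Re_sum -(pair_bigA _ (fun i j =>
    complex.Re (c i * ((c j)^*)%C * cint mu (g (i, j))))) /= [RHS]mulr_sumr.
  apply: eq_bigr => i _; rewrite [RHS]mulr_sumr [RHS]big_mkcond; apply: eq_bigr => j _.
  rewrite /g /= orth mulrC ReZ.
  by case: (e i j); rewrite ?mulr1 ?mulr0 ?mul0r.
rewrite /L2norm unlock.
under eq_integral => z _.
  rewrite abse_EFin ger0_norm ?cabs_ge0// poweR_EFin -[2]/(2%:R) powR_mulrn ?cabs_ge0//.
  over.
rewrite -[X in (X `^ _)%E]fineK; last first.
  exact: (integrable_fin_num measurableT (bmeas_integrable mu bFF)).
rewrite poweR_EFin -/(Rintegral mu setT _) E powR12_sqrt// -E.
by apply: Rintegral_ge0 => z _; rewrite sqr_ge0.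
Qed.

Lemma prod_indicator (R : comNzRingType) (I : finType) (b : I -> bool) :
  \prod_i (b i)%:R = [forall i, b i]%:R :> R.
Proof.
have [/forallP H|/forallPn[i /negbTE bi]] := boolP [forall i, b i].
  by rewrite big1// => i _; rewrite H.
by rewrite (bigD1 i)//= bi mul0r.
Qed.

Section Orthogonality.
Variable R : realType.

Definition vol (k : nat) : R := (2 * pi) ^+ (6 * k).

Lemma vol_gt0 k : 0 < vol k.
Proof. by rewrite exprn_gt0// mulr_gt0 ?pi_gt0. Qed.

Lemma measurable_pcoord k (j : 'I_k) (i : 'I_3) :
  measurable_fun setT (fun x : config R k => pcoord x j i : measurableTypeR R).
Proof.
exact: (measurableT_comp (measurable_tnth i) (measurable_tnth j)).
Qed.

(** A variant of [pairing] with the frequency given as a function, so that a difference of two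
    frequencies needs no tuple. *)
Definition pairf k (f : 'I_k -> 'I_3 -> int) (x : config R k) : R :=
  \sum_(j < k) \sum_(i < 3) pcoord x j i * (f j i)%:~R.

Lemma measurable_pairf k (f : 'I_k -> 'I_3 -> int) : measurable_fun setT (pairf f).
Proof.
apply: measurable_sum => j; apply: measurable_sum => i.
by apply: measurable_funM => //; exact: measurable_pcoord.
Qed.

Lemma cint_pairf k (f : 'I_k -> 'I_3 -> int) :
  cint (config_measure R k) (fun x => cexpi (pairf f x)) =
  (((2 * pi) ^+ (3 * k) * [forall j, forall i, f j i == 0]%:R)%:C)%C.
Proof.
pose g j (y : Defs.space R) := \prod_(i < 3) cexpi (tnth y i * (f j i)%:~R).
have b1 j i : cbmeas (fun t : measurableTypeR R => cexpi (t * (f j i)%:~R)).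
  by apply: cbmeas_cexpi; apply: measurable_funM.
have bg j : cbmeas (g j).
  by apply: cbmeas_prod => i; exact: (cbmeas_comp (measurable_tnth i) (b1 j i)).
have -> : (fun x => cexpi (pairf f x)) = (fun x : config R k => \prod_(j < k) g j (tnth x j)).
  by apply/funext => x; rewrite cexpi_sum; apply: eq_bigr => j _; rewrite cexpi_sum.
rewrite (cint_mpow_prod (mpow (period_measure R) 3) bg).
under eq_bigr => j _.
  rewrite (cint_mpow_prod (period_measure R) (b1 j)).
  under eq_bigr do rewrite cint_period.
  over.
rewrite /=; under eq_bigr do rewrite -rmorph_prod /= big_split /= prodr_const card_ord prod_indicator.
by rewrite -rmorph_prod /= big_split /= prodr_const card_ord prod_indicator exprM.
Qed.

Definition phase k (n n' : freq k) (z : config R k * config R k) : R :=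
  pairing z.1 n - pairing z.2 n'.

Lemma measurable_phase k (n n' : freq k) : measurable_fun setT (phase n n').
Proof.
apply: measurable_funB.
  exact: (measurableT_comp (measurable_pairf (fcoord n)) measurable_fst).
exact: (measurableT_comp (measurable_pairf (fcoord n')) measurable_snd).
Qed.

Lemma freq_eqP k (n m : freq k) :
  (n == m) = [forall j, forall i, fcoord n j i - fcoord m j i == 0].
Proof.
apply/eqP/forallP => [-> j|H]; first by apply/forallP => i; rewrite subrr.
apply: eq_from_tnth => j; apply: eq_from_tnth => i.
by have /forallP/(_ i) := H j; rewrite subr_eq0 => /eqP.
Qed.

Lemma pairing_sub k (n m : freq k) (x : config R k) :
  pairing x n - pairing x m = pairf (fun j i => fcoord n j i - fcoord m j i) x.
Proof.
rewrite /pairing -sumrB; apply: eq_bigr => j _; rewrite -sumrB.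
by apply: eq_bigr => i _; rewrite -mulrBr -intrB.
Qed.

Lemma cint_phase k (n n' m m' : freq k) :
  cint (kernel_measure R k) (fun z => cexpi (phase n n' z - phase m m' z)) =
  ((vol k * ((n == m) && (n' == m'))%:R)%:C)%C.
Proof.
have -> : (fun z : config R k * config R k => cexpi (phase n n' z - phase m m' z)) =
    (fun z => cexpi (pairf (fun j i => fcoord n j i - fcoord m j i) z.1) *
              cexpi (pairf (fun j i => fcoord m' j i - fcoord n' j i) z.2)).
  apply/funext => z; rewrite -cexpiD -!pairing_sub /phase; congr cexpi; ring.
rewrite (cint_mprodM _ _ (cbmeas_cexpi (measurable_pairf _)) (cbmeas_cexpi (measurable_pairf _))).
rewrite !cint_pairf -!freq_eqP -rmorphM /= [m' == n']eq_sym mulrACA -exprD -natrM mulnb.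
by rewrite -mulnDl.
Qed.

(** The time frequency is an integer, because every |n|^2 is; hence orthogonality extends to the
    time interval [0, 2 pi]. *)
Definition stphase k (w : int) (n n' : freq k)
    (z : measurableTypeR R * (config R k * config R k)) : R :=
  z.1 * w%:~R + phase n n' z.2.

Lemma measurable_stphase k w (n n' : freq k) : measurable_fun setT (stphase w n n').
Proof.
apply: measurable_funD; first by apply: measurable_funM.
exact: (measurableT_comp (measurable_phase n n') measurable_snd).
Qed.

Lemma cint_stphase k w v (n n' m m' : freq k) :
  cint (mprod (period_measure R) (kernel_measure R k))
    (fun z => cexpi (stphase w n n' z - stphase v m m' z)) =
  ((2 * pi * vol k * [&& w == v, n == m & n' == m']%:R)%:C)%C.
Proof.
have -> : (fun z => cexpi (stphase w n n' z - stphase v m m' z)) =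
    (fun z : measurableTypeR R * (config R k * config R k) =>
      cexpi (z.1 * (w - v)%:~R) * cexpi (phase n n' z.2 - phase m m' z.2)).
  apply/funext => z; rewrite -cexpiD /stphase intrB; congr cexpi; ring.
have b1 : cbmeas (fun t : measurableTypeR R => cexpi (t * (w - v)%:~R)).
  by apply: cbmeas_cexpi; apply: measurable_funM.
have b2 : cbmeas (fun z : config R k * config R k => cexpi (phase n n' z - phase m m' z)).
  by apply: cbmeas_cexpi; apply: measurable_funB; exact: measurable_phase.
rewrite (cint_mprodM _ _ b1 b2) cint_period cint_phase -rmorphM /= subr_eq0.
by rewrite mulrACA -natrM mulnb.
Qed.

Definition trig k (I : finType) (c : I -> R[i]) (n n' : I -> freq k) :
    integral_kernel R k :=
  fun x x' => \sum_i c i * cexpi (pairing x (n i) - pairing x' (n' i)).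

Lemma fourier_trig k (I : finType) (c : I -> R[i]) (n n' : I -> freq k) m m' :
  fourier (trig c n n') m m' =
  \sum_i c i * ((vol k * ((n i == m) && (n' i == m'))%:R)%:C)%C.
Proof.
rewrite /fourier.
have -> : (fun z : config R k * config R k => trig c n n' z.1 z.2 *
      cexpi (- pairing z.1 m + pairing z.2 m')) =
    (fun z => \sum_i c i * cexpi (phase (n i) (n' i) z - phase m m' z)).
  apply/funext => z; rewrite mulr_suml; apply: eq_bigr => i _.
  by rewrite -mulrA -cexpiD /phase; congr (_ * cexpi _); rewrite opprB addrC [in RHS]addrC [in X in X + _]addrC.
rewrite (cint_sum (kernel_measure R k)) => [|i]; last first.
  by apply: cbmeas_cexpi; apply: measurable_funB; exact: measurable_phase.
by apply: eq_bigr => i _; rewrite cint_phase.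
Qed.

End Orthogonality.

(** * Multipliers and the collision operator on trigonometric polynomials *)

Section Boxes.
Variable k : nat.
Implicit Types (n m : freq k) (M : nat).

Definition inbox M n : Prop := forall j i, (absz (fcoord n j i) <= M)%N.

Lemma freq_ext n m : (forall j i, fcoord n j i = fcoord m j i) -> n = m.
Proof. by move=> H; apply: eq_from_tnth => j; apply: eq_from_tnth => i; exact: H. Qed.

Lemma fcoord_box_freq M (a : k.-tuple (3.-tuple 'I_(M.*2.+1))) j i :
  fcoord (box_freq a) j i = (tnth (tnth a j) i : nat)%:Z - M%:Z.
Proof. by rewrite /fcoord !tnth_mktuple. Qed.

Lemma inbox_box_freq M (a : k.-tuple (3.-tuple 'I_(M.*2.+1))) : inbox M (box_freq a).
Proof.
move=> j i; rewrite fcoord_box_freq.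
by have := ltn_ord (tnth (tnth a j) i); lia.
Qed.

Lemma box_freq_inj M : injective (@box_freq k M).
Proof.
move=> a b ab; apply: eq_from_tnth => j; apply: eq_from_tnth => i; apply: val_inj => /=.
have : fcoord (box_freq a) j i = fcoord (box_freq b) j i by rewrite ab.
by rewrite !fcoord_box_freq => /addIr [].
Qed.

Lemma box_freq_onto M n : inbox M n -> exists a, @box_freq k M a = n.
Proof.
move=> nM.
exists [tuple [tuple (inord (absz (fcoord n j i + M%:Z)%R) : 'I_(M.*2.+1)) | i < 3] | j < k].
apply: freq_ext => j i; rewrite fcoord_box_freq !tnth_mktuple.
have := nM j i; move: (fcoord n j i) => t tM.
by rewrite inordK; [lia | rewrite ltnS; lia].
Qed.

Lemma inbox_max (I : finType) (n : I -> freq k) :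
  exists M, forall M', (M <= M')%N -> forall i, inbox M' (n i).
Proof.
exists (\sum_i \sum_j \sum_l absz (fcoord (n i) j l))%N => M' MM' i j l.
apply: leq_trans MM'; rewrite (bigD1 i)//= (bigD1 j)//= (bigD1 l)//=.
by rewrite -!addnA leq_addr.
Qed.

End Boxes.

Section Multiplier.
Variables (R : realType) (k : nat).
Implicit Types (m : freq k -> freq k -> R[i]) (g h : integral_kernel R k).

Lemma eq_multiplier m g h : (forall n n', fourier g n n' = fourier h n n') ->
  multiplier m g = multiplier m h.
Proof.
move=> gh; rewrite /multiplier.
suff -> : (fun n n' => m n n' * fourier g n n') = (fun n n' => m n n' * fourier h n n') by [].
by apply/funext => n; apply/funext => n'; rewrite gh.
Qed.

Lemma clim_near (u : nat -> R[i]) (L : R[i]) N :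
  (forall M, (N <= M)%N -> u M = L) -> clim u = L.
Proof.
move=> H; apply: complex_ext; rewrite /clim /=; apply: lim_near_cst => //;
  by exists N => // M NM; rewrite H.
Qed.

Lemma sum_box_freq M (G : freq k -> freq k -> R[i]) n n' : inbox M n -> inbox M n' ->
  \sum_(a : k.-tuple (3.-tuple 'I_(M.*2.+1)))
    \sum_(a' : k.-tuple (3.-tuple 'I_(M.*2.+1)))
    ((n == box_freq a) && (n' == box_freq a'))%:R * G (box_freq a) (box_freq a') = G n n'.
Proof.
move=> /box_freq_onto[a <-] /box_freq_onto[a' <-].
rewrite (bigD1 a)//= (bigD1 a')//= !eqxx mul1r big1 ?addr0.
  rewrite big1 ?addr0// => b ba; rewrite big1// => b' _.
  by rewrite (inj_eq (@box_freq_inj _ _)) eq_sym (negbTE ba) mul0r.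
by move=> b' ba; rewrite [X in _ && X](inj_eq (@box_freq_inj _ _)) [a' == _]eq_sym (negbTE ba) andbF mul0r.
Qed.

(** Once the cube contains all the frequencies that occur, the partial Fourier sums are stationary,
    so the limit is attained; the factor [vol] of the coefficients cancels the normalisation of the
    series. *)
Lemma multiplier_trig m (I : finType) (c : I -> R[i]) (n n' : I -> freq k) :
  multiplier m (trig c n n') = trig (fun i => m (n i) (n' i) * c i) n n'.
Proof.
have [M HM] := inbox_max n; have [M' HM'] := inbox_max n'.
apply/funext => x; apply/funext => x'.
apply: (@clim_near _ _ (maxn M M')) => N; rewrite geq_max => /andP[/HM nN /HM' n'N].
rewrite /partial_fourier_series /trig.
transitivity (\sum_i \sum_(a : k.-tuple (3.-tuple 'I_(N.*2.+1)))
    \sum_(a' : k.-tuple (3.-tuple 'I_(N.*2.+1)))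
    ((n i == box_freq a) && (n' i == box_freq a'))%:R *
    (m (box_freq a) (box_freq a') * c i *
      cexpi (pairing x (box_freq a) - pairing x' (box_freq a')))); last first.
  by apply: eq_bigr => i _; rewrite (sum_box_freq
    (fun b b' => m b b' * c i * cexpi (pairing x b - pairing x' b')) (nN i) (n'N i)).
rewrite [RHS]exchange_big [LHS]mulr_sumr; apply: eq_bigr => a _ /=.
rewrite [RHS]exchange_big [LHS]mulr_sumr; apply: eq_bigr => a' _ /=.
rewrite fourier_trig !(mulr_sumr, mulr_suml); apply: eq_bigr => i _.
have v0 : ((vol R k)%:C)%C != 0 by rewrite eq_complex /= eqxx andbT gt_eqF// vol_gt0.
rewrite -/(vol R k) rmorphM /= !rmorphV ?unitfE ?gt_eqF ?vol_gt0//= rmorph_nat.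
by field.
Qed.

(* Together with [eq_multiplier]: as multipliers only see Fourier coefficients, a
   band-limited g, which is merely integrable, may be replaced by a
   trigonometric polynomial. *)
Lemma fourier_band_trig M g : (forall n n', ~ (inbox M n /\ inbox M n') -> fourier g n n' = 0) ->
  let I := (k.-tuple (3.-tuple 'I_(M.*2.+1)) * k.-tuple (3.-tuple 'I_(M.*2.+1)))%type in
  forall n n', fourier g n n' =
    fourier (trig (fun a : I => (((vol R k)^-1)%:C)%C * fourier g (box_freq a.1) (box_freq a.2))
      (fun a : I => box_freq a.1) (fun a : I => box_freq a.2)) n n'.
Proof.
move=> H I n n'; rewrite fourier_trig.
have v0 : ((vol R k)%:C)%C != 0 by rewrite eq_complex /= eqxx andbT gt_eqF// vol_gt0.
transitivity (\sum_(a : I) ((n == box_freq a.1) && (n' == box_freq a.2))%:R *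
    fourier g (box_freq a.1) (box_freq a.2)); last first.
  apply: eq_bigr => a _; rewrite rmorphM /= !rmorphV ?unitfE ?gt_eqF ?vol_gt0//= rmorph_nat.
  by rewrite [n == _]eq_sym [n' == _]eq_sym; field.
have [[nM nM']|nM] := pselect (inbox M n /\ inbox M n').
  rewrite -(pair_bigA _ (fun a a' => ((n == box_freq a) && (n' == box_freq a'))%:R *
    fourier g (box_freq a) (box_freq a')))/=.
  by rewrite (sum_box_freq (fourier g) nM nM').
rewrite (H _ _ nM) big1// => a _.
have [/andP[/eqP E /eqP E']|_] := boolP (_ && _); last by rewrite mul0r.
by case: nM; rewrite E E'; split; exact: inbox_box_freq.
Qed.

End Multiplier.

Section Collision.
Variables (k : nat) (j : 'I_k).
Implicit Types (n m : freq k.+1).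

Definition wid (l : 'I_k) : 'I_k.+1 := widen_ord (leqnSn k) l.

Definition finit n : freq k := [tuple tnth n (wid l) | l < k].

(* Setting the last variable y equal to x_j in exp(i (n . (x, y) - m . (x', y)))
   gives the frequency [collide n m] in x and [finit m] in x'. *)
Definition collide n m : freq k :=
  [tuple [tuple fcoord n (wid l) i + (if l == j then fcoord n ord_max i - fcoord m ord_max i else 0)
    | i < 3] | l < k].

Lemma fcoord_finit n l i : fcoord (finit n) l i = fcoord n (wid l) i.
Proof. by rewrite /fcoord tnth_mktuple. Qed.

Lemma fcoord_collide n m l i : fcoord (collide n m) l i =
  fcoord n (wid l) i + (if l == j then fcoord n ord_max i - fcoord m ord_max i else 0).
Proof. by rewrite /fcoord !tnth_mktuple. Qed.

Variable R : realType.

Lemma tnth_extend_wid (x : config R k) y l : tnth (extend x y) (wid l) = tnth x l.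
Proof.
rewrite (tnth_nth (tnth x l)) /= nth_rcons size_tuple ltn_ord.
by rewrite -tnth_nth.
Qed.

Lemma tnth_extend_max (x : config R k) y : tnth (extend x y) ord_max = y.
Proof. by rewrite (tnth_nth y) /= nth_rcons size_tuple ltnn eqxx. Qed.

Lemma pairing_extend (x : config R k) y n : pairing (extend x y) n =
  pairing x (finit n) + \sum_(i < 3) tnth y i * (fcoord n ord_max i)%:~R.
Proof.
rewrite /pairing big_ord_recr /=; congr (_ + _).
  apply: eq_bigr => l _; apply: eq_bigr => i _.
  by rewrite /pcoord -/(wid l) tnth_extend_wid fcoord_finit.
by apply: eq_bigr => i _; rewrite /pcoord tnth_extend_max.
Qed.

Lemma pairing_collide (x : config R k) n m : pairing x (collide n m) =
  pairing x (finit n) +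
  \sum_(i < 3) pcoord x j i * (fcoord n ord_max i - fcoord m ord_max i)%:~R.
Proof.
rewrite /pairing [LHS](bigD1 j)//= [X in X + _ = _](_ : _ =
  \sum_(i < 3) pcoord x j i * (fcoord (finit n) j i)%:~R +
  \sum_(i < 3) pcoord x j i * (fcoord n ord_max i - fcoord m ord_max i)%:~R).
  rewrite addrAC [in RHS](bigD1 j)//=; congr (_ + _ + _).
  apply: eq_bigr => l lj; apply: eq_bigr => i _.
  by rewrite fcoord_collide (negbTE lj) addr0 fcoord_finit.
rewrite -big_split; apply: eq_bigr => i _ /=.
by rewrite fcoord_collide eqxx fcoord_finit intrD mulrDr.
Qed.

Lemma cint_dirac d (T : measurableType d) (y : T) (f : T -> R[i]) :
  cbmeas f -> cint (@dirac _ _ y R) f = f y.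
Proof.
move=> [[m1 _] [m2 _]]; apply: complex_ext; rewrite /cint /= /Rintegral.
  by rewrite integral_dirac ?diracT ?mul1e//; exact/measurable_EFinP.
by rewrite integral_dirac ?diracT ?mul1e//; exact/measurable_EFinP.
Qed.

Lemma cbmeas_trig_extend (I : finType) (c : I -> R[i]) (n n' : I -> freq k.+1) x x' :
  cbmeas (fun y => trig c n n' (extend x y) (extend x' y)).
Proof.
apply: cbmeas_sum => i; apply: cbmeasM; first exact: cbmeas_cst.
apply: cbmeas_cexpi.
under eq_fun do rewrite !pairing_extend.
have ms (q : freq k.+1) : measurable_fun setT (fun y : Defs.space R =>
    \sum_(i < 3) tnth y i * (fcoord q ord_max i)%:~R : measurableTypeR R).
  apply: measurable_sum => l; apply: measurable_funM => //; exact: measurable_tnth.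
by apply: measurable_funB; apply: measurable_funD => //; exact: ms.
Qed.

(** The Boolean separates the two parts of the operator: for B+ the contracted variable is x_j and
    its net frequency joins n_j; for B- it is x_j', and the net frequency joins n_j' with the
    opposite sign. *)
Lemma B_op_trig (I : finType) (c : I -> R[i]) (n n' : I -> freq k.+1) :
  B_op j (trig c n n') =
  trig (fun q : I * bool => (if q.2 then 1 else -1) * c q.1)
    (fun q => if q.2 then collide (n q.1) (n' q.1) else finit (n q.1))
    (fun q => if q.2 then finit (n' q.1) else collide (n' q.1) (n q.1)).
Proof.
apply/funext => x; apply/funext => x'.
rewrite /B_op /Bplus /Bminus !cint_dirac; try exact: cbmeas_trig_extend.
rewrite /trig -(pair_bigA _ (fun i b => (if b then 1 else -1) * c i *
  cexpi (pairing x (if b then collide (n i) (n' i) else finit (n i)) -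
    pairing x' (if b then finit (n' i) else collide (n' i) (n i)))))/=.
rewrite -sumrB; apply: eq_bigr => i _; rewrite big_bool /= !mul1r mulN1r mulNr.
have E (y : config R k) (q q' : freq k.+1) :
    \sum_(l < 3) pcoord y j l * (fcoord q ord_max l - fcoord q' ord_max l)%:~R =
    \sum_(l < 3) tnth (tnth y j) l * (fcoord q ord_max l)%:~R -
    \sum_(l < 3) tnth (tnth y j) l * (fcoord q' ord_max l)%:~R.
  by rewrite -sumrB; apply: eq_bigr => l _; rewrite intrB mulrBr.
congr (_ * cexpi _ - _ * cexpi _); rewrite !pairing_extend pairing_collide E; ring.
Qed.

End Collision.

(** * Sobolev weights of the collision terms and the Schur test *)

Section Symbols.
Variable R : realType.

Definition fvec k (n : freq k) (l : 'I_k) : vec3 :=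
  (fcoord n l 0, fcoord n l 1, fcoord n l 2%:R).

Lemma fvec_inj k (n m : freq k) : (forall l, fvec n l = fvec m l) -> n = m.
Proof.
move=> H; apply: freq_ext => l i; have [e0 e1 e2] := H l.
case: i => -[|[|[|//]]] lt.
- by rewrite (_ : Ordinal lt = 0) //; apply: val_inj.
- by rewrite (_ : Ordinal lt = 1) //; apply: val_inj.
- by rewrite (_ : Ordinal lt = 2%:R) //; apply: val_inj.
Qed.

Lemma fvec_finit k (n : freq k.+1) l : fvec (finit n) l = fvec n (wid l).
Proof. by rewrite /fvec !fcoord_finit. Qed.

Lemma fvec_collide k (j : 'I_k) (n m : freq k.+1) :
  fvec (collide j n m) j = fvec n (wid j) + fvec n ord_max - fvec m ord_max.
Proof. by rewrite /fvec !fcoord_collide eqxx !addrA. Qed.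

Lemma fvec_collide_neq k (j l : 'I_k) (n m : freq k.+1) : l != j ->
  fvec (collide j n m) l = fvec n (wid l).
Proof. by move=> lj; rewrite /fvec !fcoord_collide (negbTE lj) !addr0. Qed.

Definition dsq k (n : freq k) (l : 'I_k) : int := dot (fvec n l) (fvec n l).

Lemma sqnorm1E k (n : freq k) l : sqnorm1 R n l = (dsq n l)%:~R.
Proof.
rewrite /sqnorm1 !big_ord_recl big_ord0 addr0 /dsq /dot /= addrA !rmorphD !rmorphM /= -!expr2.
by congr (_ ^+ 2 + _ ^+ 2 + _ ^+ 2); congr (fcoord n l _)%:~R; apply: val_inj.
Qed.

Definition isq k (n : freq k) : int := \sum_(l < k) dsq n l.

Lemma sqnormE k (n : freq k) : sqnorm R n = (isq n)%:~R.
Proof. by rewrite /sqnorm /isq rmorph_sum; apply: eq_bigr => l _; rewrite sqnorm1E. Qed.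

Definition Sr k (n n' : freq k) : R :=
  \prod_(l < k) (Num.sqrt (1 + sqnorm1 R n l) * Num.sqrt (1 + sqnorm1 R n' l)).

Lemma S_symbolE k (n n' : freq k) : S_symbol R n n' = ((Sr n n')%:C)%C.
Proof. by []. Qed.

Lemma Sr_sym k (n n' : freq k) : Sr n n' = Sr n' n.
Proof. by apply: eq_bigr => l _; rewrite mulrC. Qed.

Lemma Sr_gt0 k (n n' : freq k) : 0 < Sr n n'.
Proof.
by apply: prodr_gt0 => l _; rewrite mulr_gt0// sqrtr_gt0 sqnorm1E; exact: (@jap_gt0 R).
Qed.

Lemma Sr_sqr k (n n' : freq k) :
  Sr n n' ^+ 2 = \prod_(l < k) (jap R (fvec n l) * jap R (fvec n' l)).
Proof.
rewrite -prodrXl; apply: eq_bigr => l _.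
by rewrite exprMn !sqr_sqrtr ?sqnorm1E//; exact/ltW/(@jap_gt0 R).
Qed.

(** The factor by which S amplifies a B+ term: its symbol at the output frequency over its symbol at
    the input frequency. *)
Definition weight k (j : 'I_k) (n n' : freq k.+1) : R :=
  Sr (collide j n n') (finit n') / Sr n n'.

Definition triple k (j : 'I_k) (n n' : freq k.+1) : vec3 * vec3 * vec3 :=
  (fvec n (wid j), fvec n ord_max, fvec n' ord_max).

(** All variables but x_j and the contracted ones keep their frequencies in the collision, so their
    brackets cancel between numerator and denominator. *)
Lemma weight_sqr k (j : 'I_k) (n n' : freq k.+1) :
  weight j n n' ^+ 2 =
  jap R (fvec (collide j n n') j) / (jap R (triple j n n').1.1 *
    jap R (triple j n n').1.2 * jap R (triple j n n').2).
Proof.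
have jn0 v : jap R v != 0 by rewrite gt_eqF// jap_gt0.
rewrite /weight exprMn exprVn !Sr_sqr [in X in _ / X]big_ord_recr /= -/(wid _).
rewrite (bigD1 j)//= [in X in _ / X](bigD1 j)//=.
under [X in _ * X / _]eq_bigr => l lj do rewrite fvec_collide_neq// fvec_finit.
rewrite fvec_finit -/(wid j).
set Q := \prod_(i < k | _) _.
have Q0 : Q != 0 by apply/prodf_neq0 => l _; rewrite mulf_neq0.
by rewrite /triple /=; field; rewrite !jn0 Q0.
Qed.

Lemma supn_fvec k (n : freq k) M l : inbox M n -> (supn (fvec n l) <= M)%N.
Proof. by move=> H; rewrite /supn !geq_max !H. Qed.

(** The output (P, Q) prescribes every input frequency except n_j, n_(k+1) and n'_(k+1). Inputs are
    therefore counted by this triple, which is resonant with nu = P_j, and the bound does not depend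
    on k. *)
Lemma weight_sum (C : R) (L M : nat) (HC : forall nu tau,
    sum_le (resonant nu tau M)
      (fun z => jap R nu / (jap R z.1.1 * jap R z.1.2 * jap R z.2)) (C * L%:R ^+ 2))
    k (j : 'I_k) (I : finType) (f g : I -> freq k.+1) (P Q : freq k) (w : int) :
  (forall a b, f a = f b -> g a = g b -> a = b) ->
  (forall a, inbox M (f a) /\ inbox M (g a)) ->
  \sum_(a | [&& isq (f a) - isq (g a) == w, collide j (f a) (g a) == P & finit (g a) == Q])
    weight j (f a) (g a) ^+ 2 <= C * L%:R ^+ 2.
Proof.
move=> inj inb.
(* What is left of [w] for |n_j|^2 + |n_(k+1)|^2 - |n'_(k+1)|^2 when the prescribed frequencies are
   removed. *)
pose tau := w - \sum_(l < k | l != j) dsq P l + \sum_(l < k) dsq Q l.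
pose b a := [&& isq (f a) - isq (g a) == w, collide j (f a) (g a) == P & finit (g a) == Q].
under eq_bigr do rewrite weight_sqr.
rewrite (eq_bigr (fun a => jap R (fvec P j) / (jap R (triple j (f a) (g a)).1.1 *
    jap R (triple j (f a) (g a)).1.2 * jap R (triple j (f a) (g a)).2))); last first.
  by move=> a /and3P[_ /eqP -> _].
rewrite -big_filter -(big_map (fun a => triple j (f a) (g a)) xpredT
  (fun z => jap R (fvec P j) / (jap R z.1.1 * jap R z.1.2 * jap R z.2))).
apply: (HC (fvec P j) tau).
  rewrite map_inj_in_uniq ?filter_uniq ?index_enum_uniq// => a a'.
  rewrite !mem_filter => /andP[/and3P[_ /eqP eP /eqP eQ] _].
  move=> /andP[/and3P[_ /eqP eP' /eqP eQ'] _] [] e1 e2 e3 e4 e5 e6 e7 e8 e9.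
  have t1 : fvec (f a) (wid j) = fvec (f a') (wid j) by rewrite /fvec e1 e2 e3.
  have t2 : fvec (f a) ord_max = fvec (f a') ord_max by rewrite /fvec e4 e5 e6.
  have t3 : fvec (g a) ord_max = fvec (g a') ord_max by rewrite /fvec e7 e8 e9.
  have split_ord (l : 'I_k.+1) : l = ord_max \/ exists l', l = wid l'.
    have [->|lm] := eqVneq l ord_max; [by left | right].
    have lt : (l < k)%N.
      by have := ltn_ord l; rewrite ltnS leq_eqVlt => /orP[/eqP E|//]; case/eqP: lm; apply: val_inj.
    by exists (Ordinal lt); apply: val_inj.
  apply: inj; apply: fvec_inj => l; have [->//|[l' ->]] := split_ord l.
    have [->//|lj] := eqVneq l' j.
    by rewrite -(fvec_collide_neq _ (g a) lj) eP -eP' fvec_collide_neq.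
  by rewrite -fvec_finit eQ -eQ' fvec_finit.
move=> z /mapP[a]; rewrite mem_filter => /andP[/and3P[/eqP ew /eqP eP /eqP eQ] _] ->.
have [fa ga] := inb a.
split; rewrite /triple /=; try exact: supn_fvec.
  by rewrite -eP fvec_collide.
rewrite /tau -ew -eP -eQ.
rewrite (eq_bigr (fun l => dsq (f a) (wid l))); last first.
  by move=> l lj; rewrite /dsq fvec_collide_neq.
rewrite [X in _ = _ + X](eq_bigr (fun l => dsq (g a) (wid l))); last first.
  by move=> l _; rewrite /dsq fvec_finit.
have -> : isq (f a) = dsq (f a) (wid j) +
    \sum_(l < k | l != j) dsq (f a) (wid l) + dsq (f a) ord_max.
  by rewrite /isq big_ord_recr /= (bigD1 j).
have -> : isq (g a) = \sum_(l < k) dsq (g a) (wid l) + dsq (g a) ord_max.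
  by rewrite /isq big_ord_recr.
rewrite /dsq; ring.
Qed.

End Symbols.

(** Cauchy-Schwarz with the factors crossed, [w j] against [d i], produces two sums that the
    symmetry of [e] exchanges, so the bound for the row sums of w^2 serves both. *)
Lemma schur_bound (R : realType) (I : finType) (e : rel I) (c : I -> R[i])
    (w d : I -> R) (K : R) : symmetric e ->
  (forall i, 0 <= w i) -> (forall i, 0 <= d i) -> (forall i, cabs (c i) = w i * d i) ->
  (forall i, \sum_(j | e i j) w j ^+ 2 <= K) ->
  \sum_i \sum_(j | e i j) complex.Re (c i * ((c j)^*)%C) <= K * \sum_i d i ^+ 2.
Proof.
move=> es w0 d0 cE HK.
have S : \sum_i \sum_(j | e i j) w j ^+ 2 * d i ^+ 2 <= K * \sum_i d i ^+ 2.
  rewrite mulr_sumr; apply: ler_sum => i _.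
  by rewrite -mulr_suml ler_wpM2r ?sqr_ge0.
have S' : \sum_i \sum_(j | e i j) w i ^+ 2 * d j ^+ 2 <= K * \sum_i d i ^+ 2.
  apply: le_trans S; rewrite (exchange_big_dep predT)//=.
  by under eq_bigr => j _ do under eq_bigl => i do rewrite es.
have -> : K * \sum_i d i ^+ 2 = 2^-1 * (K * \sum_i d i ^+ 2 + K * \sum_i d i ^+ 2).
  by field.
apply: le_trans (_ : 2^-1 * (\sum_i \sum_(j | e i j) w j ^+ 2 * d i ^+ 2 +
  \sum_i \sum_(j | e i j) w i ^+ 2 * d j ^+ 2) <= _); last first.
  by rewrite ler_wpM2l ?invr_ge0// lerD.
rewrite -big_split mulr_sumr; apply: ler_sum => i _ /=.
rewrite -big_split mulr_sumr; apply: ler_sum => j _ /=.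
(* AM-GM: 2 (w_i d_i) (w_j d_j) <= (w_j d_i)^2 + (w_i d_j)^2 *)
apply: le_trans (Re_mulJ_le _ _) _; rewrite !cE.
by have := sqr_ge0 (w j * d i - w i * d j); nra.
Qed.

(** * Norms, the frequency cutoff and the final estimate *)

Section Norms.
Variables (R : realType) (k : nat).
Implicit Types (M : nat).

Definition boxes M : finType :=
  (k.-tuple (3.-tuple 'I_(M.*2.+1)) * k.-tuple (3.-tuple 'I_(M.*2.+1)))%type.

(** Distinct indices carry distinct frequencies here, so the relation in [L2norm_trig] is
    equality. *)
Lemma kernel_L2norm_trig M (c : boxes M -> R[i]) :
  kernel_L2norm (trig c (fun a => box_freq a.1) (fun a => box_freq a.2)) =
  (Num.sqrt (vol R k * \sum_a cabs (c a) ^+ 2))%:E.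
Proof.
rewrite /kernel_L2norm.
have -> : uncurry_kernel (trig c (fun a => box_freq a.1) (fun a => box_freq a.2)) =
   (fun z => \sum_a c a * cexpi (phase (box_freq a.1) (box_freq a.2) z)) by [].
rewrite (@L2norm_trig _ _ _ (kernel_measure R k) _ _ _ (vol R k) eq_op).
- congr (Num.sqrt (_ * _))%:E; apply: eq_bigr => a _.
  by rewrite (big_pred1 a) ?cabs_sqr// => b; rewrite eq_sym.
- by move=> a; exact: measurable_phase.
- by move=> [a a'] [b b']; rewrite cint_phase /= !(inj_eq (@box_freq_inj _ _)).
Qed.

End Norms.

(** Each coordinate is bounded by the Euclidean norm and, being an integer, by the integer part of
    N. *)
Lemma inbox_band (R : realType) k (N : R) (g : integral_kernel R k) :
  band_limited N g ->
  forall n n', ~ (inbox (Num.truncn N) n /\ inbox (Num.truncn N) n') -> fourier g n n' = 0.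
Proof.
move=> gN n n' H; apply: gN; apply: contrapT => /forallNP H'; apply: H.
have P (m : freq k) l : ~ N < norm1 R m l -> forall i, (absz (fcoord m l i) <= Num.truncn N)%N.
  move=> /negP; rewrite -leNgt => le i.
  have h : (absz (fcoord m l i))%:R <= N.
    apply: le_trans le; rewrite /norm1 natr_absz intr_norm -sqrtr_sqr ler_wsqrtr//.
    by rewrite /sqnorm1 (bigD1 i)//= lerDl sumr_ge0// => ? _; rewrite sqr_ge0.
  by rewrite truncn_ge_nat// (le_trans _ h).
by split => l; apply: P => lt; case: (H' l); [left | right].
Qed.

(** The logarithm rounded up exceeds log_2 N by at most 1, and the successor adds another unit; each
    unit is at most ln N / ln N0. *)
Lemma log_scale_bound (R : realType) (N0 N : R) : 1 < N0 -> N0 <= N ->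
  (up_log 2 (Num.truncn N)).+1%:R <= ((ln 2)^-1 + 2 * (ln N0)^-1) * ln N.
Proof.
move=> N01 N0N.
have l2 : 0 < ln 2 :> R by rewrite ln_gt0// ltr1n.
have l0 : 0 < ln N0 by rewrite ln_gt0.
have lN : ln N0 <= ln N by rewrite ler_ln ?posrE; lra.
have a1 : 1 <= (ln N0)^-1 * ln N by rewrite mulrC ler_pdivlMr ?mul1r.
suff : (up_log 2 (Num.truncn N))%:R <= (ln 2)^-1 * ln N + 1.
  by rewrite -natr1 mulrDl -mulrA; lra.
have [le1|gt1] := leqP (Num.truncn N) 1.
  have -> : up_log 2 (Num.truncn N) = 0%N by apply/eqP; rewrite up_log_eq0 le1.
  by rewrite addr_ge0// mulr_ge0 ?invr_ge0 ?ltW//; lra.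
have := up_log_gtn (isT : (1 < 2)%N) gt1.
have : (0 < up_log 2 (Num.truncn N))%N by rewrite up_log_gt0.
case: up_log => // l _ /= H; rewrite -natr1 lerD2r mulrC ler_pdivlMr//.
have N_ge0 : 0 <= N by lra.
have : (2 ^ l)%:R <= N.
  by rewrite -truncn_ge_nat// ltnW.
rewrite natrX => h; rewrite mulr_natl -lnXn// ler_ln ?posrE ?exprn_gt0//; lra.
Qed.

Local Close Scope classical_set_scope.
Unset Implicit Arguments.

(** As ln N vanishes at N = 1, the cutoff is kept above a fixed N0 > 1; [C1] depends on N0, but not
    on N, gamma, k or j. *)
Theorem proposition3p2 (R : realType) (N0 : R) (hN0 : 1 < N0) :
  exists C1 : R, 0 < C1 /\
    forall (N : R), N0 <= N ->
    forall (gamma : forall k : nat, integral_kernel R k),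
      (forall k : nat, (0 < k)%N -> density_matrix (gamma k)) ->
      in_H1 gamma ->
      (forall k : nat, (0 < k)%N -> band_limited N (gamma k)) ->
      forall (k : nat) (j : 'I_k),
        (spacetime_L2norm (fun t => S_op (B_op j (U_op t (gamma k.+1))))
         <= (C1 * ln N)%:E * kernel_L2norm (S_op (gamma k.+1)))%E.
Proof.
have [C C0 HC] := sum_resonant R.
have l2 : 0 < ln 2 :> R by rewrite ln_gt0// ltr1n.
have l0 : 0 < ln N0 by rewrite ln_gt0.
pose c0 := (ln 2)^-1 + 2 * (ln N0)^-1.
have c0_gt0 : 0 < c0 by rewrite addr_gt0 ?mulr_gt0 ?invr_gt0.
have sC : 0 < Num.sqrt C by rewrite sqrtr_gt0.
(* The Schur constant is 2 C L^2, one C L^2 for each of B+ and B-, and every coefficient of gamma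
   enters twice; the square root of 4 C L^2 is 2 sqrt(C) L. *)
exists (2 * Num.sqrt C * c0); split; first by rewrite !mulr_gt0.
move=> N N0N gamma _ _ band k j.
have lN0 : 0 < ln N by rewrite ln_gt0; lra.
pose M := Num.truncn N; pose L := (up_log 2 M).+1.
have LN : L%:R <= c0 * ln N by exact: log_scale_bound.
pose I := boxes k.+1 M.
pose n (a : I) := box_freq a.1; pose n' (a : I) := box_freq a.2.
pose c (a : I) : R[i] := (((vol R k.+1)^-1)%:C)%C * fourier (gamma k.+1) (n a) (n' a).
have gT (m : freq k.+1 -> freq k.+1 -> R[i]) :
    multiplier m (gamma k.+1) = trig (fun a => m (n a) (n' a) * c a) n n'.
  rewrite (eq_multiplier _ (fourier_band_trig (inbox_band (band k.+1 isT)))).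
  exact: multiplier_trig.
(* Modulus of the coefficient of S gamma at the frequency (n a, n' a). *)
pose D a := Sr R (n a) (n' a) * cabs (c a).
have D0 a : 0 <= D a by rewrite mulr_ge0 ?cabs_ge0// ltW// Sr_gt0.
have -> : kernel_L2norm (S_op (gamma k.+1)) =
    (Num.sqrt (vol R k.+1 * \sum_a D a ^+ 2))%:E.
  rewrite /S_op gT kernel_L2norm_trig; congr (Num.sqrt (_ * _))%:E.
  by apply: eq_bigr => a _; rewrite cabsM S_symbolE cabs_real// ltW// Sr_gt0.
pose p (q : I * bool) := if q.2 then collide j (n q.1) (n' q.1) else finit (n q.1).
pose p' (q : I * bool) := if q.2 then finit (n' q.1) else collide j (n' q.1) (n q.1).
pose w (a : I) := isq (n a) - isq (n' a).
pose b (q : I * bool) : R[i] := S_symbol R (p q) (p' q) * ((if q.2 then 1 else -1) * c q.1).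
(* U, B and S act term by term on trigonometric polynomials, which leaves a trigonometric polynomial
   in space-time; the free evolution supplies the time frequency - w. *)
have -> : spacetime_L2norm (fun t => S_op (B_op j (U_op t (gamma k.+1)))) =
    L2norm (mprod (period_measure R) (kernel_measure R k))
      (fun z => \sum_q b q * cexpi (stphase (- w q.1) (p q) (p' q) z)).
  rewrite /spacetime_L2norm; congr L2norm; apply/funext => z.
  rewrite /U_op gT B_op_trig /S_op multiplier_trig /trig; apply: eq_bigr => q _.
  rewrite /stphase [in RHS]cexpiD /phase [RHS]mulrA; congr (_ * _).
  rewrite /b /U_symbol !sqnormE -intrB -/(w q.1) mulrNz mulrN.
  by move: (c q.1) => x; rewrite -!mulrA; congr (_ * (_ * _)); rewrite mulrC.
pose e (q r : I * bool) := [&& - w q.1 == - w r.1, p q == p r & p' q == p' r].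
rewrite (@L2norm_trig _ _ _ (mprod (period_measure R) (kernel_measure R k)) _ _ _
  (2 * pi * vol R k) e) => [|q|q r]; first last.
- exact: cint_stphase.
- exact: measurable_stphase.
(* In a B- term the frequencies n and n' exchange roles, so its weight is that of a B+ term for (n',
   n). *)
pose W (q : I * bool) := if q.2 then weight R j (n q.1) (n' q.1) else weight R j (n' q.1) (n q.1).
have schur : \sum_(q : (I * bool)%type) \sum_(r | e q r) complex.Re (b q * ((b r)^*)%C) <=
    (C * L%:R ^+ 2 + C * L%:R ^+ 2) * \sum_(q : (I * bool)%type) D q.1 ^+ 2.
  apply: (@schur_bound _ _ e b W (fun q => D q.1)) => [q r|q|q|q|q].
  - by rewrite /e eq_sym [p q == _]eq_sym [p' q == _]eq_sym.
  - by rewrite /W; case: q.2; rewrite divr_ge0 ?ltW ?Sr_gt0.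
  - exact: D0.
  - rewrite /b cabsM S_symbolE cabs_real; last exact/ltW/Sr_gt0.
    have -> : cabs ((if q.2 then 1 else -1) * c q.1) = cabs (c q.1).
      by case: q.2; rewrite ?mul1r// mulN1r cabsN.
    rewrite /D mulrA; congr (_ * _).
    rewrite /W /p /p' /weight; case: q.2; rewrite ?(Sr_sym _ (n' _)) ?divfK ?gt_eqF ?Sr_gt0//.
    by rewrite Sr_sym.
  - have inj a a' : n a = n a' -> n' a = n' a' -> a = a'.
      by case: a a' => [? ?] [? ?] /box_freq_inj /= -> /box_freq_inj /= ->.
    have inb a : inbox M (n a) /\ inbox M (n' a) by split; exact: inbox_box_freq.
    (* The row sum splits into the B+ and the B- terms that share the output frequency of q, each
       part being at most C L^2. *)
    rewrite big_mkcond -(pair_bigA _ (fun a s => if e q (a, s) then W (a, s) ^+ 2 else 0)) /=.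
    under eq_bigr do rewrite big_bool /=.
    rewrite big_split /= -!big_mkcond lerD//.
      rewrite (eq_bigl (fun a => [&& isq (n a) - isq (n' a) == w q.1,
        collide j (n a) (n' a) == p q & finit (n' a) == p' q])); last first.
        by move=> a; rewrite /e eqr_opp [p q == _]eq_sym [p' q == _]eq_sym [w q.1 == _]eq_sym.
      exact: (weight_sum (fun nu tau => HC nu tau M)).
    (* Exchanging n and n' negates w and swaps the two output frequencies. *)
    rewrite (eq_bigl (fun a => [&& isq (n' a) - isq (n a) == - w q.1,
      collide j (n' a) (n a) == p' q & finit (n a) == p q])); last first.
      move=> a; rewrite /e [p q == _]eq_sym [p' q == _]eq_sym [- w q.1 == _]eq_sym /w opprB /=.
      by congr (_ && _); rewrite andbC.
    apply: (weight_sum (fun nu tau => HC nu tau M)) => [a a' ? ?|a]; first exact: inj.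
    by have [] := inb a.
pose X := \sum_a D a ^+ 2.
have X0 : 0 <= X by apply: sumr_ge0 => a _; rewrite sqr_ge0.
have DX : \sum_(q : (I * bool)%type) D q.1 ^+ 2 = 2 * X.
  rewrite -(pair_bigA _ (fun a (_ : bool) => D a ^+ 2))/= mulr_sumr.
  by apply: eq_bigr => a _; rewrite big_bool /= -mulr2n mulr_natl.
rewrite DX in schur; rewrite -EFinM lee_fin -/X.
have K0 : 0 <= 2 * Num.sqrt C * c0 * ln N by rewrite !mulr_ge0// ltW.
have KE : 2 * Num.sqrt C * c0 * ln N = Num.sqrt ((2 * Num.sqrt C * c0 * ln N) ^+ 2).
  by rewrite sqrtr_sqr ger0_norm.
rewrite KE -sqrtrM ?sqr_ge0//; apply: ler_wsqrtr.
have pi1 : 1 <= 2 * pi :> R by have := @pi_ge2 R; lra.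
(* Parseval gives the volume 2 pi vol(k) on the left and vol(k+1) = (2 pi)^6 vol(k) on the right, so
   the volumes compare favourably as 2 pi >= 1. *)
have volE : vol R k.+1 = (2 * pi) ^+ 6 * vol R k by rewrite /vol mulnS exprD.
have pi6 : 2 * pi <= (2 * pi) ^+ 6 :> R.
  by rewrite exprS ler_peMr ?exprn_ege1//; lra.
have v0 := vol_gt0 R k.
have LL : L%:R ^+ 2 <= (c0 * ln N) ^+ 2 :> R.
  by rewrite lerXn2r ?nnegrE// mulr_ge0// ltW.
rewrite volE; apply: le_trans (ler_wpM2l _ schur) _; first by rewrite mulr_ge0 ?ltW//; lra.
have -> : (2 * Num.sqrt C * c0 * ln N) ^+ 2 = 4 * C * (c0 * ln N) ^+ 2.
  have sq : Num.sqrt C ^+ 2 = C by rewrite sqr_sqrtr// ltW.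
  by rewrite -[in RHS]sq; ring.
have -> : 2 * pi * vol R k * ((C * L%:R ^+ 2 + C * L%:R ^+ 2) * (2 * X)) =
  (4 * C * L%:R ^+ 2) * (2 * pi * (vol R k * X)) by ring.
have pi0 : 0 <= 2 * pi :> R by lra.
have vX : 0 <= vol R k * X by rewrite mulr_ge0// ltW.
apply: ler_pM.
- by rewrite mulr_ge0 ?sqr_ge0// mulr_ge0// ltW.
- exact: mulr_ge0.
- by rewrite ler_wpM2l// mulr_ge0// ltW.
- by rewrite -[leRHS]mulrA ler_wpM2r.
Qed.
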